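(* Let $K$ be a field and let $A$ be a finite dimensional $K$-algebra. If there is a positive integer $n$ such that every finite dimensional brick over $A$ (i.e. every brick in $\mathrm{mod}\,A$) has less than $n$ composition factors, then $A$ is $\tau$-tilting finite.
   Context: $K$ is an arbitrary field (not necessarily algebraically closed), and $\mathrm{mod}\,A$ is the category of finitely generated right $A$-modules. ''Module'' means object of $\mathrm{mod}\,A$. A brick is a module $B$ whose endomorphism algebra $\mathrm{End}_A(B)$ is a division ring (in particular $B\neq 0$). The number of composition factors of a module is its length, i.e. composition factors are counted with multiplicity. Let $r$ be the number of isomorphism classes of simple $A$-modules (the rank of the Grothendieck group $K_0(A)$). Nakayama functor: $\nu=\mathrm{Hom}_K(\mathrm{Hom}_A(-,A),K)$. Auslander-Reiten translation: if $P_1\to P_0\to M\to 0$ is the minimal projective presentation of $M$, then $\tau M$ is the kernel of $\nu P_1\to\nu P_0$. A module $M$ is $\tau$-rigid if $\mathrm{Hom}_A(M,\tau M)=0$. A pair $(M,P)$ with $M$ a module and $P$ a projective module, both basic (no two distinct indecomposable direct summands in a decomposition of $M$, respectively of $P$, are isomorphic), is a $\tau$-rigid pair if $M$ is $\tau$-rigid and $\mathrm{Hom}_A(P,M)=0$. A $\tau$-rigid pair $(M,P)$ is a $\tau$-tilting pair if the number of pairwise non-isomorphic indecomposable direct summands of $M\oplus P$ is equal to $r$. $A$ is $\tau$-tilting finite if there are only finitely many $\tau$-tilting pairs up to isomorphism (by a known theorem of Demonet-Iyama-Jasso this is equivalent to there being only finitely many isomorphism classes of bricks in $\mathrm{mod}\,A$).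 *)

(* Defs.v *)
From HB Require Import structures.
From mathcomp Require Import all_boot all_algebra all_field.

Set Implicit Arguments.
Unset Strict Implicit.
Unset Printing Implicit Defensive.

Import GRing.Theory.
Local Open Scope ring_scope.

Lemma linfunE (K : fieldType) (U V : vectType K) (f : U -> V) :
  linear f -> linfun f =1 f.
Proof.
move=> lin_f.
pose fL := GRing.isLinear.Build K U V *:%R f lin_f.
pose ff : {linear U -> V} := HB.pack f fL.
exact: (lfunE ff).
Qed.

Lemma lfunLE (K : fieldType) (U V : vectType K) (k : K) (f g : 'Hom(U, V)) u :
  (k *: f + g) u = k *: f u + g u.
Proof. by rewrite add_lfunE scale_lfunE. Qed.

(* [falgType K] is a finite dimensional [K]-algebra. Over such an algebra a
   finitely generated module is the same thing as a finite dimensional one, so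
   the carrier of an object of mod A is a [vectType K]. *)
Record rmod (K : fieldType) (A : falgType K) := RMod {
  rcar :> vectType K;
  ract : rcar -> A -> rcar;
  ract_linearl : forall a : A, linear (ract^~ a);
  ract_linearr : forall x : rcar, linear (ract x);
  ract1 : forall x : rcar, ract x 1 = x;
  ractM : forall (x : rcar) (a b : A), ract x (a * b) = ract (ract x a) b }.

Section Modules.

Variables (K : fieldType) (A : falgType K).
Implicit Types M N P X Y T : rmod A.

Definition lact M (a : A) : 'End(M) := linfun (fun x : M => ract x a).

Lemma lactE M a (x : M) : lact M a x = ract x a.
Proof. exact/linfunE/ract_linearl. Qed.

Lemma lact_linear M : linear (lact M).
Proof.
move=> k a b; apply/lfunP => x.
by rewrite lfunLE !lactE ract_linearr.
Qed.

(* The map f |-> (a |-> f(- a) - f(-) a), whose kernel is Hom_A(M, N). *)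
Definition defect M N (f : 'Hom(M, N)) : 'Hom(A, 'Hom(M, N)) :=
  linfun (fun a : A => (f \o lact M a)%VF - (lact N a \o f)%VF).

Lemma defectE M N (f : 'Hom(M, N)) (a : A) (x : M) :
  defect f a x = f (ract x a) - ract (f x) a.
Proof.
rewrite linfunE; first by rewrite add_lfunE opp_lfunE !comp_lfunE !lactE.
move=> k b c; apply/lfunP => y.
rewrite lfunLE !(add_lfunE, opp_lfunE, comp_lfunE) !lactE.
by rewrite !ract_linearr linearP scalerBr opprD addrACA.
Qed.

Lemma defect_linear M N : linear (@defect M N).
Proof.
move=> k f g; apply/lfunP => a; apply/lfunP => x.
rewrite !(lfunLE, defectE) ract_linearl.
by rewrite scalerBr opprD addrACA.
Qed.

Definition homA M N : {vspace 'Hom(M, N)} := lker (linfun (@defect M N)).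

Lemma homAP M N (f : 'Hom(M, N)) :
  reflect (forall (x : M) (a : A), f (ract x a) = ract (f x) a)
          (f \in homA M N).
Proof.
rewrite memv_ker linfunE; last exact: defect_linear.
apply: (iffP eqP) => [f0 x a | fA].
  by apply/eqP; rewrite -subr_eq0 -defectE f0 !lfunE.
by apply/lfunP => a; apply/lfunP => x; rewrite defectE fA subrr !lfunE.
Qed.

Definition hom M N := subvs_of (homA M N).

Definition iso M N : Prop :=
  exists2 f : 'Hom(M, N), f \in homA M N &
  exists2 g : 'Hom(N, M), g \in homA N M &
    (g \o f)%VF = \1%VF /\ (f \o g)%VF = \1%VF.

Definition is_zero M : Prop := forall x : M, x = 0.

Definition submod M (U : {vspace M}) : Prop :=
  forall (x : M) (a : A), x \in U -> ract x a \in U.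

Definition simple M : Prop :=
  ~ is_zero M /\
  forall U : {vspace M}, submod U -> U = 0%VS \/ U = fullv.

Definition brick M : Prop :=
  ~ is_zero M /\
  forall f : 'End(M), f \in homA M M -> f != 0 ->
    exists2 g : 'End(M), g \in homA M M &
      (g \o f)%VF = \1%VF /\ (f \o g)%VF = \1%VF.

(* [V / U] is a simple module. *)
Definition covers M (U V : {vspace M}) : Prop :=
  [/\ submod U, submod V, (U <= V)%VS, U <> V &
      forall W : {vspace M}, submod W -> (U <= W)%VS -> (W <= V)%VS ->
        W = U \/ W = V].

(* [M] has a composition series with [l] factors; by Jordan-Hoelder at most one
   [l] satisfies this. *)
Definition has_length M (l : nat) : Prop :=
  exists U : nat -> {vspace M},
    [/\ U 0%N = 0%VS, U l = fullv &
        forall i : nat, (i < l)%N -> covers (U i) (U i.+1)].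

Section Zero.

Let act0 (x : 'rV[K]_0) (a : A) := x.

Fact act0_linearl a : linear (act0^~ a). Proof. by []. Qed.

Fact act0_linearr x : linear (act0 x).
Proof. by move=> k a b; rewrite !thinmx0. Qed.

Definition rmod0 : rmod A :=
  @RMod K A _ act0 act0_linearl act0_linearr
    (fun=> erefl) (fun _ _ _ => erefl).

End Zero.

Section DirectSum.

Variables M N : rmod A.

Let actS (x : (M * N)%type) (a : A) : (M * N)%type := (ract x.1 a, ract x.2 a).

Fact actS_linearl a : linear (actS^~ a).
Proof. by move=> k x y; congr pair; apply: ract_linearl. Qed.

Fact actS_linearr x : linear (actS x).
Proof. by move=> k a b; congr pair; apply: ract_linearr. Qed.

Fact actS1 x : actS x 1 = x.
Proof. by case: x => x y; congr pair; apply: ract1. Qed.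

Fact actSM x a b : actS x (a * b) = actS (actS x a) b.
Proof. by congr pair; apply: ractM. Qed.

Definition dsum : rmod A := RMod actS_linearl actS_linearr actS1 actSM.

End DirectSum.

Section Regular.

Fact mulA_linearl (a : A) : linear (fun x : A => x * a).
Proof. by move=> k x y; rewrite mulrDl scalerAl. Qed.

Fact mulA_linearr (x : A) : linear (fun a : A => x * a).
Proof. by move=> k a b; rewrite mulrDr scalerAr. Qed.

Definition regular : rmod A :=
  @RMod K A A (fun x a => x * a) mulA_linearl mulA_linearr
    (@mulr1 A) (@mulrA A).

End Regular.

Section Submodule.

Variables (M : rmod A) (U : {vspace M}) (subU : submod U).

Let actU (x : subvs_of U) (a : A) : subvs_of U :=
  Subvs (subU a (subvsP x)).

Fact actU_linearl a : linear (actU^~ a).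
Proof. by move=> k x y; apply: val_inj; rewrite /= ract_linearl. Qed.

Fact actU_linearr x : linear (actU x).
Proof. by move=> k a b; apply: val_inj; rewrite /= ract_linearr. Qed.

Fact actU1 x : actU x 1 = x.
Proof. by apply: val_inj; rewrite /= ract1. Qed.

Fact actUM x a b : actU x (a * b) = actU (actU x a) b.
Proof. by apply: val_inj; rewrite /= ractM. Qed.

Definition rsub : rmod A := RMod actU_linearl actU_linearr actU1 actUM.

End Submodule.

Fact ker_submod M N (f : hom M N) : submod (lker (vsval f)).
Proof.
move=> x a; rewrite !memv_ker => /eqP fx0.
have /homAP -> := subvsP f; rewrite fx0 -lactE.
by rewrite linear0.
Qed.

Definition rker M N (f : hom M N) : rmod A := rsub (@ker_submod M N f).

(* The contravariant functor Hom_A(-, A), with the left A-action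
   (a h)(x) = a * h(x). *)
Section Dual.

Definition lmulA (a : A) : 'End(A) := linfun (fun x : A => a * x).

Lemma lmulAE (a x : A) : lmulA a x = a * x.
Proof. exact/linfunE/mulA_linearr. Qed.

Fact ldual_subproof M (a : A) (h : hom M regular) :
  (lmulA a \o (vsval h : 'Hom(M, A)))%VF \in homA M regular.
Proof.
apply/homAP => x b; rewrite !comp_lfunE !lmulAE.
by have /homAP -> := subvsP h; apply: mulrA.
Qed.

Definition ldual_act M (a : A) (h : hom M regular) : hom M regular :=
  Subvs (ldual_subproof a h).

Lemma ldual_actE M a (h : hom M regular) (x : M) :
  vsval (ldual_act a h) x = a * vsval h x.
Proof. by rewrite comp_lfunE lmulAE. Qed.

Fact hom_comp_subproof M N P (f : hom M N) (h : hom N P) :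
  (vsval h \o vsval f)%VF \in homA M P.
Proof.
apply/homAP => x a; rewrite !comp_lfunE.
by have /homAP -> := subvsP f; have /homAP -> := subvsP h.
Qed.

Definition hom_comp M N P (f : hom M N) (h : hom N P) : hom M P :=
  Subvs (hom_comp_subproof f h).

End Dual.

Lemma hom_eqP M N (f g : hom M N) : (forall x, vsval f x = vsval g x) -> f = g.
Proof. by move=> fg; apply/val_inj/lfunP. Qed.

Lemma ldual_act_linear M a : linear (@ldual_act M a).
Proof.
move=> k g h; apply: hom_eqP => x /=.
by rewrite !(lfunLE) !comp_lfunE !lmulAE
           !(lfunLE) mulrDr scalerAr.
Qed.

Lemma hom_comp_linear M N P (f : hom M N) : linear (@hom_comp M N P f).
Proof.
move=> k g h; apply: hom_eqP => x /=.
by rewrite !(lfunLE, comp_lfunE).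
Qed.

(* The Nakayama functor Hom_K(Hom_A(-, A), K), with the right A-action
   (phi a)(h) = phi(a h). *)
Section Nakayama.

Variable M : rmod A.

Let actN (phi : 'Hom(hom M regular, K^o)) (a : A) : 'Hom(hom M regular, K^o) :=
  (phi \o linfun (@ldual_act M a))%VF.

Let actNE phi a h : actN phi a h = phi (ldual_act a h).
Proof. by rewrite comp_lfunE linfunE //; apply: ldual_act_linear. Qed.

Fact actN_linearl a : linear (actN^~ a).
Proof.
by move=> k f g; apply/lfunP => h; rewrite !(lfunLE, actNE).
Qed.

Fact actN_linearr phi : linear (actN phi).
Proof.
move=> k a b; apply/lfunP => h.
rewrite !(lfunLE, actNE) -linearP; congr (phi _).
apply: hom_eqP => x /=.
by rewrite !(lfunLE, comp_lfunE, lmulAE) mulrDl scalerAl.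
Qed.

Fact actN1 phi : actN phi 1 = phi.
Proof.
apply/lfunP => h; rewrite actNE; congr (phi _); apply: hom_eqP => x.
by rewrite ldual_actE mul1r.
Qed.

Fact actNM phi a b : actN phi (a * b) = actN (actN phi a) b.
Proof.
apply/lfunP => h; rewrite !actNE; congr (phi _); apply: hom_eqP => x.
by rewrite !ldual_actE mulrA.
Qed.

Definition nakayama : rmod A := RMod actN_linearl actN_linearr actN1 actNM.

Lemma nakayama_actE (phi : nakayama) a h :
  (ract phi a : 'Hom(hom M regular, K^o)) h
    = (phi : 'Hom(hom M regular, K^o)) (ldual_act a h).
Proof. exact: actNE. Qed.

End Nakayama.

Section NakayamaMap.

Variables (M N : rmod A) (f : hom M N).

Definition nakayama_fun : 'Hom(nakayama M, nakayama N) :=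
  linfun (fun phi : 'Hom(hom M regular, K^o) =>
    (phi \o linfun (@hom_comp M N regular f))%VF).

Lemma nakayama_funE (phi : nakayama M) (h : hom N regular) :
  (nakayama_fun phi : 'Hom(hom N regular, K^o)) h
    = (phi : 'Hom(hom M regular, K^o)) (hom_comp f h).
Proof.
rewrite linfunE; last first.
  by move=> k p q; apply/lfunP => g;
    rewrite !(lfunLE, comp_lfunE).
by rewrite comp_lfunE linfunE //; apply: hom_comp_linear.
Qed.

Fact nakayama_subproof : nakayama_fun \in homA (nakayama M) (nakayama N).
Proof.
apply/homAP => phi a; apply/lfunP => h.
rewrite (nakayama_funE (ract phi a)) (nakayama_actE phi).
rewrite (nakayama_actE (nakayama_fun phi)) (nakayama_funE phi).
congr ((phi : 'Hom(_, _)) _); apply: hom_eqP => x.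
by rewrite /= !comp_lfunE.
Qed.

Definition nakayama_map : hom (nakayama M) (nakayama N) :=
  Subvs nakayama_subproof.

End NakayamaMap.

Definition projective P : Prop :=
  forall (M N : rmod A) (g : hom M N) (f : hom P N),
    limg (vsval g) = fullv -> exists h : hom P M, hom_comp h g = f.

Definition superfluous M (U : {vspace M}) : Prop :=
  forall V : {vspace M}, submod V -> (V + U)%VS = fullv -> V = fullv.

(* P1 --f--> P0 --g--> M --> 0 is exact, and P0 -> M and P1 -> ker g are
   projective covers. *)
Definition min_proj_presentation P1 P0 M (f : hom P1 P0) (g : hom P0 M) : Prop :=
  [/\ projective P1 /\ projective P0,
      limg (vsval g) = fullv, limg (vsval f) = lker (vsval g),
      superfluous (lker (vsval g)) & superfluous (lker (vsval f))].

(* [T] is a copy of tau M, which is determined up to isomorphism. *)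
Definition is_tau M T : Prop :=
  exists (P1 P0 : rmod A) (f : hom P1 P0) (g : hom P0 M),
    min_proj_presentation f g /\ iso T (rker (nakayama_map f)).

Definition tau_rigid M : Prop :=
  exists2 T : rmod A, is_tau M T & homA M T = 0%VS.

Definition indecomposable M : Prop :=
  ~ is_zero M /\
  forall X Y, iso M (dsum X Y) -> is_zero X \/ is_zero Y.

Definition basic M : Prop :=
  forall (k : nat) (X : 'I_k -> rmod A),
    (forall i, indecomposable (X i)) ->
    iso M (\big[dsum/rmod0]_(i < k) X i) ->
    forall i j, iso (X i) (X j) -> i = j.

Definition summand X M : Prop := exists Y, iso M (dsum X Y).

(* Exactly [k] isomorphism classes of modules satisfy [Q]. *)
Definition num_iso_classes (Q : rmod A -> Prop) (k : nat) : Prop :=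
  exists X : 'I_k -> rmod A,
    [/\ forall i, Q (X i), forall i j, iso (X i) (X j) -> i = j &
        forall Y, Q Y -> exists i, iso Y (X i)].

Definition tau_rigid_pair M P : Prop :=
  [/\ basic M, basic P, projective P, tau_rigid M & homA P M = 0%VS].

Definition tau_tilting_pair M P : Prop :=
  tau_rigid_pair M P /\
  exists2 r : nat, num_iso_classes simple r &
    num_iso_classes
      (fun X => indecomposable X /\ summand X (dsum M P)) r.

End Modules.

Definition tau_tilting_finite (K : fieldType) (A : falgType K) : Prop :=
  exists (k : nat) (T : 'I_k -> rmod A * rmod A),
    forall M P : rmod A, tau_tilting_pair M P ->
      exists i, iso M (T i).1 /\ iso P (T i).2.

(* Main.v *)
(** For a [tau]-rigid module [M] with minimal projective presentation
    [P1 -> P0 -> M -> 0], put [theta (X) = dim Hom (P0, X) - dim Hom (P1, X)],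
    which is additive on short exact sequences.  By the Auslander-Reiten formula
    [X] lies in Fac [M] if and only if [theta (Y) > 0] for all nonzero quotients
    [Y] of [X].  If bricks have bounded length, their quotients have finitely
    many dimension vectors, so finitely many sign patterns of [theta] decide
    which bricks lie in Fac [M].  A torsion class is determined by its bricks:
    a module of minimal dimension in Fac [M] but not in Fac [M'] is a brick.
    Hence there are finitely many classes Fac [M].  An indecomposable [M] is
    determined by Fac [M], by Nakayama's lemma over its local endomorphism ring,
    so there are finitely many indecomposable [tau]-rigid modules and, by the
    same argument with [P1 = 0], finitely many indecomposable projectives.  The
    two components of a [tau]-tilting pair are direct sums of pairwise
    non-isomorphic modules of these kinds. *)

Require Import Defs.
From mathcomp Require Import all_boot all_order all_algebra all_field.
From mathcomp Require Import ring.
From Stdlib Require Import ClassicalEpsilon.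

Set Implicit Arguments.
Unset Strict Implicit.
Unset Printing Implicit Defensive.

Import Order.TTheory GRing.Theory Num.Theory.
Local Open Scope ring_scope.

(** * Extremal choices *)

Lemma argminP (T : Type) (Q : T -> Prop) (h : T -> nat) (x0 : T) :
  Q x0 -> exists2 x, Q x & forall y, Q y -> (h x <= h y)%N.
Proof.
have [n] := ubnP (h x0); elim: n x0 => // n IHn x0 /ltnSE le_n Qx0.
have [[y Qy lt_y]|no_y] := classic (exists2 y, Q y & (h y < h x0)%N).
  by apply: (IHn y) => //; apply: leq_trans lt_y le_n.
exists x0 => // y Qy; rewrite leqNgt; apply/negP => lt_y.
by apply: no_y; exists y.
Qed.

Lemma argmaxP (T : Type) (Q : T -> Prop) (h : T -> nat) (b : nat) (x0 : T) :
  (forall x, Q x -> (h x <= b)%N) -> Q x0 ->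
  exists2 x, Q x & forall y, Q y -> (h y <= h x)%N.
Proof.
move=> le_b /(argminP (fun x => b - h x)%N) [x Qx min_x]; exists x => // y Qy.
by have := min_x _ Qy; rewrite leq_sub2lE ?le_b.
Qed.

(** * Linear algebra and Fitting's lemma *)

Section LinearMaps.

Variables (K : fieldType) (V : vectType K).

Lemma memv_compl_projv (U : {vspace V}) x :
  (x \in lker (\1 - projv U)%VF) = (x \in U).
Proof.
rewrite memv_ker add_lfunE opp_lfunE id_lfunE subr_eq0.
apply/eqP/idP => [->|/projv_id-> //]; exact: memv_proj.
Qed.

(** The component of [x] outside [U] has a nonzero coordinate; take that coordinate after the
    projection killing [U]. *)
Lemma separating_functional (U : {vspace V}) x :
  x \notin U ->
  exists2 phi : 'Hom(V, K^o), (forall u, u \in U -> phi u = 0) & phi x != 0.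
Proof.
move=> xU; pose y := (\1 - projv U)%VF x.
have y0 : y != 0 by rewrite -memv_ker memv_compl_projv.
have [i yi] : exists i, coord (vbasis {:V}) i y != 0.
  apply/existsP; apply: contraR y0; rewrite negb_exists => /forallP y0.
  apply/eqP; rewrite (coord_vbasis (memvf y)) big1 // => i _.
  by have := y0 i; rewrite negbK => /eqP->; rewrite scale0r.
pose c := linfun (coord (vbasis {:V}) i : V -> K^o).
exists (c \o (\1 - projv U))%VF => [u uU|]; last by rewrite comp_lfunE lfunE.
rewrite comp_lfunE; have:= memv_compl_projv U u.
by rewrite uU memv_ker => /eqP->; rewrite linear0.
Qed.

Definition powlf (f : 'End(V)) (n : nat) : 'End(V) :=
  iter n (fun g => (f \o g)%VF) \1%VF.

Lemma powlfE f n x : powlf f n x = iter n f x.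
Proof. by elim: n => [|n IHn]; rewrite /= ?id_lfunE // comp_lfunE IHn. Qed.

Lemma powlfD f m n x : powlf f (m + n) x = powlf f m (powlf f n x).
Proof. by rewrite !powlfE iterD. Qed.

Lemma sub_ker_powlf f m n :
  (m <= n)%N -> (lker (powlf f m) <= lker (powlf f n))%VS.
Proof.
move=> /subnK <-; apply/subvP => x; rewrite !memv_ker powlfD => /eqP->.
by rewrite linear0.
Qed.

(** The kernels of the powers grow, so they are constant from one of maximal dimension on. All
    larger [n] are allowed, so that one exponent can serve two endomorphisms. *)
Lemma fitting f : exists m, forall n x, (m <= n)%N ->
  powlf f n (powlf f n x) = 0 -> powlf f n x = 0.
Proof.
have le_b n : True -> (\dim (lker (powlf f n)) <= \dim {:V})%N.
  by rewrite dimvS ?subvf.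
have [m _ max_m] := argmaxP le_b (I : (fun=> True) 0%N).
have ker_m n : (m <= n)%N -> lker (powlf f n) = lker (powlf f m).
  move=> le_mn; apply/esym/eqP.
  by rewrite eqEdim sub_ker_powlf //= max_m.
exists m => n x le_mn; rewrite -powlfD => ff0.
have : x \in lker (powlf f (n + n)) by rewrite memv_ker ff0.
rewrite ker_m; last by rewrite (leq_trans le_mn) ?leq_addr.
by rewrite -(ker_m _ le_mn) memv_ker => /eqP.
Qed.

Lemma powlf_eq0_ker_sub1 f n : powlf f n = 0 -> lker (\1 - f)%VF = 0%VS.
Proof.
move=> fn0; apply/eqP; rewrite -subv0; apply/subvP => x.
rewrite memv_ker add_lfunE opp_lfunE id_lfunE subr_eq0 => /eqP xf.
have : powlf f n x = x by rewrite powlfE; elim: {fn0} n => //= n ->.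
by rewrite fn0 zero_lfunE => <-; rewrite mem0v.
Qed.

End LinearMaps.

(** * Module homomorphisms and submodules *)

Section Morphisms.

Variables (K : fieldType) (A : falgType K).
Implicit Types M N P X Y Z : rmod A.

(** Homomorphisms are handled as linear maps with this property rather than as elements of the
    subtype [hom]; [homAP] translates. *)
Definition Alin X Y (f : 'Hom(X, Y)) : Prop :=
  forall x a, f (ract x a) = ract (f x) a.

Lemma ractD X (x y : X) a : ract (x + y) a = ract x a + ract y a.
Proof. by rewrite -!lactE linearD. Qed.

Lemma ractN X (x : X) a : ract (- x) a = - ract x a.
Proof. by rewrite -!lactE linearN. Qed.

Lemma ract0 X a : ract (0 : X) a = 0.
Proof. by rewrite -lactE linear0. Qed.

Lemma ract_sum X I (r : seq I) (Q : pred I) (F : I -> X) a :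
  ract (\sum_(i <- r | Q i) F i) a = \sum_(i <- r | Q i) ract (F i) a.
Proof. by rewrite -lactE linear_sum; apply: eq_bigr => i _; apply: lactE. Qed.

Definition ractl X (x : X) : 'Hom(A, X) := linfun (ract x).

Lemma ractlE X (x : X) a : ractl x a = ract x a.
Proof. exact/linfunE/ract_linearr. Qed.

Lemma Alin_ractl X (x : X) : @Alin (regular A) X (ractl x).
Proof. by move=> a b; rewrite !ractlE ractM. Qed.

Lemma Alin_id X : @Alin X X \1%VF.
Proof. by move=> x a; rewrite !id_lfunE. Qed.

Lemma Alin0 X Y : @Alin X Y 0.
Proof. by move=> x a; rewrite !zero_lfunE ract0. Qed.

Lemma Alin_comp X Y Z (f : 'Hom(X, Y)) (g : 'Hom(Y, Z)) :
  Alin f -> Alin g -> Alin (g \o f)%VF.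
Proof. by move=> fA gA x a; rewrite !comp_lfunE fA gA. Qed.

Lemma AlinB X Y (f g : 'Hom(X, Y)) : Alin f -> Alin g -> Alin (f - g).
Proof.
by move=> fA gA x a; rewrite !add_lfunE !opp_lfunE fA gA ractD ractN.
Qed.

Lemma Alin_powlf X (f : 'End(X)) n : Alin f -> Alin (powlf f n).
Proof.
by move=> fA; elim: n => [|n IHn]; [apply: Alin_id | apply: Alin_comp].
Qed.

Lemma submod_ker X Y (f : 'Hom(X, Y)) : Alin f -> submod (lker f).
Proof. by move=> fA x a; rewrite !memv_ker fA => /eqP->; rewrite ract0. Qed.

Lemma submod_limg X Y (f : 'Hom(X, Y)) (U : {vspace X}) :
  Alin f -> submod U -> submod (f @: U)%VS.
Proof.
move=> fA sU _ a /memv_imgP[x xU ->]; rewrite -fA memv_img //; exact: sU.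
Qed.

Lemma submod0 X : submod (0%VS : {vspace X}).
Proof. by move=> x a; rewrite !memv0 => /eqP->; rewrite ract0. Qed.

Lemma submodf X : submod (fullv : {vspace X}).
Proof. by move=> x a _; rewrite memvf. Qed.

Lemma submodD X (U V : {vspace X}) : submod U -> submod V -> submod (U + V)%VS.
Proof.
move=> sU sV _ a /memv_addP[u uU [v vV ->]].
by rewrite ractD memv_add ?sU ?sV.
Qed.

Lemma submodI X (U V : {vspace X}) : submod U -> submod V -> submod (U :&: V)%VS.
Proof.
by move=> sU sV x a; rewrite !memv_cap => /andP[xU xV]; rewrite sU ?sV.
Qed.

Lemma Alin_inv X Y (f : 'Hom(X, Y)) :
  Alin f -> lker f = 0%VS -> limg f = fullv ->
  [/\ Alin (f^-1)%VF, (f^-1 \o f = \1)%VF & (f \o f^-1 = \1)%VF].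
Proof.
move=> fA f_inj f_surj.
have fK : cancel f (f^-1)%VF by apply/lker0_lfunK/eqP.
have fVK y : f (f^-1%VF y) = y by apply: limg_lfunVK; rewrite f_surj memvf.
split; [|by apply/lfunP => x; rewrite comp_lfunE fK id_lfunE
        |by apply/lfunP => x; rewrite comp_lfunE fVK id_lfunE].
by move=> y a; apply: (can_inj fK); rewrite fA !fVK.
Qed.

Lemma Alin_endo_inv X (f : 'End(X)) : Alin f -> lker f = 0%VS ->
  [/\ Alin (f^-1)%VF, (f^-1 \o f = \1)%VF & (f \o f^-1 = \1)%VF].
Proof. by move=> fA f_inj; apply: Alin_inv => //; apply/lker0_limgf/eqP. Qed.

Definition incl X (U : {vspace X}) : 'Hom(subvs_of U, X) := linfun vsval.

Lemma inclE X (U : {vspace X}) (u : subvs_of U) : incl U u = vsval u.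
Proof. by rewrite lfunE. Qed.

Lemma Alin_incl X (U : {vspace X}) (sU : submod U) : @Alin (rsub sU) X (incl U).
Proof. by move=> u a; rewrite !inclE. Qed.

Definition corestr X Y (V : {vspace Y}) (f : 'Hom(X, Y)) : 'Hom(X, subvs_of V) :=
  (linfun (vsproj V) \o f)%VF.

Lemma corestrE X Y (V : {vspace Y}) (f : 'Hom(X, Y)) x :
  f x \in V -> vsval (corestr V f x) = f x.
Proof. by move=> fV; rewrite comp_lfunE lfunE vsprojK. Qed.

Lemma Alin_corestr X Y (V : {vspace Y}) (sV : submod V) (f : 'Hom(X, Y)) :
  Alin f -> (limg f <= V)%VS -> @Alin X (rsub sV) (corestr V f).
Proof.
move=> fA /subvP fV x a; have fVx y : f y \in V by apply/fV/memv_img/memvf.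
by apply: val_inj; rewrite /= !corestrE.
Qed.

End Morphisms.

(** * Quotients and trace submodules *)

Section Quotient.

Variables (K : fieldType) (A : falgType K) (X : rmod A).
Variables (U : {vspace X}) (sU : submod U).

(** The quotient lives on the image of [p], a complement of [U]. The algebra acts through a preimage
    under [p]; by [actQE] its choice is immaterial, as [U] is a submodule. *)
Let p : 'End(X) := (\1 - projv U)%VF.
Let Q := subvs_of (limg p).
Let actQ (q : Q) (a : A) : Q := vsproj _ (p (ract (p^-1%VF (vsval q)) a)).

Definition quo_map : 'Hom(X, Q) := (linfun (vsproj (limg p)) \o p)%VF.

Let quo_mapE x : vsval (quo_map x) = p x.
Proof. by rewrite comp_lfunE lfunE vsprojK ?memv_img ?memvf. Qed.

Let quo_sec (q : Q) : quo_map (p^-1%VF (vsval q)) = q.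
Proof. by apply: val_inj; rewrite /= quo_mapE limg_lfunVK ?subvsP. Qed.

Lemma lker_quo : lker quo_map = U.
Proof.
apply/vspaceP => x; rewrite -(memv_compl_projv U) !memv_ker.
by rewrite -(inj_eq (@subvs_inj _ _ (limg p))) quo_mapE linear0.
Qed.

Lemma limg_quo : limg quo_map = fullv.
Proof.
by apply/vspaceP => q; rewrite memvf -[q]quo_sec memv_img ?memvf.
Qed.

Let actQE x a : actQ (quo_map x) a = quo_map (ract x a).
Proof.
apply: val_inj; rewrite /= quo_mapE vsprojK ?memv_img ?memvf //.
apply/eqP; rewrite -subr_eq0 -linearB -memv_ker memv_compl_projv -ractN -ractD.
by apply: sU; rewrite -lker_quo memv_ker linearB /= quo_sec subrr.
Qed.

Fact actQ_linearl a : linear (actQ^~ a).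
Proof.
move=> k q1 q2; rewrite -[q1]quo_sec -[q2]quo_sec -linearP !actQE.
by rewrite [in LHS]ract_linearl linearP.
Qed.

Fact actQ_linearr q : linear (actQ q).
Proof.
by move=> k a b; rewrite -[q]quo_sec !actQE -linearP ract_linearr.
Qed.

Fact actQ1 q : actQ q 1 = q.
Proof. by rewrite -[q]quo_sec actQE ract1. Qed.

Fact actQM q a b : actQ q (a * b) = actQ (actQ q a) b.
Proof. by rewrite -[q]quo_sec !actQE ractM. Qed.

Definition rquo : rmod A := RMod actQ_linearl actQ_linearr actQ1 actQM.

Lemma Alin_quo : @Alin _ _ X rquo quo_map.
Proof. by move=> x a; rewrite -actQE. Qed.

End Quotient.

Section Trace.

Variables (K : fieldType) (A : falgType K).
Implicit Types M N P X Y Z T : rmod A.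

(* [X] lies in Fac [M] if and only if [trace M X] is the whole of [X]. *)
Definition trace M X : {vspace X} :=
  (\sum_(i < \dim (homA M X)) limg (vbasis (homA M X))`_i)%VS.

Lemma limg_trace M X (f : 'Hom(M, X)) : Alin f -> (limg f <= trace M X)%VS.
Proof.
move=> /homAP fA; apply/subvP => _ /memv_imgP[x _ ->].
rewrite (coord_vbasis fA) sum_lfunE memv_suml // => i _.
rewrite scale_lfunE memvZ //; have := memv_img (vbasis (homA M X))`_i (memvf x).
by apply/subvP; apply: (sumv_sup i).
Qed.

Lemma trace_sub M X (U : {vspace X}) :
  (forall f : 'Hom(M, X), Alin f -> (limg f <= U)%VS) -> (trace M X <= U)%VS.
Proof.
move=> fU; apply/subv_sumP => i _; apply/fU/homAP/vbasis_mem/mem_nth.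
by rewrite size_tuple.
Qed.

Lemma submod_trace M X : submod (trace M X).
Proof.
move=> x a /memv_sumP[v v_img ->]; rewrite ract_sum memv_suml // => i _.
have fA : Alin (vbasis (homA M X))`_i.
  by apply/homAP/vbasis_mem/mem_nth; rewrite size_tuple.
apply: (subvP (limg_trace fA)).
by apply: submod_limg => //; [apply: submodf | apply: v_img].
Qed.

Lemma limg_trace_sub M X Y (f : 'Hom(X, Y)) :
  Alin f -> (f @: trace M X <= trace M Y)%VS.
Proof.
move=> fA; rewrite limg_sum; apply/subv_sumP => i _; rewrite -limg_comp.
apply/limg_trace/Alin_comp => //; apply/homAP/vbasis_mem/mem_nth.
by rewrite size_tuple.
Qed.

Lemma fac_quotient M X Y (f : 'Hom(X, Y)) :
  Alin f -> limg f = fullv -> trace M X = fullv -> trace M Y = fullv.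
Proof.
move=> fA f_surj tX; apply: subv_anti; rewrite subvf -f_surj -tX.
exact: limg_trace_sub.
Qed.

Lemma fac_self M : trace M M = fullv.
Proof.
apply: subv_anti; rewrite subvf -[X in (X <= _)%VS](lim1g fullv).
exact/limg_trace/Alin_id.
Qed.

Lemma fac_trans M N X (p : 'Hom(M, N)) :
  Alin p -> limg p = fullv -> trace N X = fullv -> trace M X = fullv.
Proof.
move=> pA p_surj tX; apply: subv_anti; rewrite subvf -tX.
apply: trace_sub => f fA; rewrite -p_surj -limg_comp.
exact/limg_trace/Alin_comp.
Qed.

(** Every homomorphism from [M] to [X] lands in the trace, hence factors through it. *)
Lemma fac_trace M X : trace M (rsub (@submod_trace M X)) = fullv.
Proof.
set T := rsub _; have fac_in : (trace M X <= incl _ @: trace M T)%VS.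
  apply: trace_sub => f fA; apply/subvP => _ /memv_imgP[x _ ->].
  have tf := limg_trace fA; pose f' := corestr (trace M X) f.
  have f'A : @Alin _ _ M T f' by apply: Alin_corestr.
  rewrite -(corestrE (subvP tf _ (memv_img f (memvf x)))) -inclE.
  rewrite memv_img //; apply: subvP (limg_trace f'A) _ _.
  exact/memv_img/memvf.
apply/vspaceP => y; rewrite memvf.
have /memv_imgP[z zT] := subvP fac_in _ (subvsP y).
by rewrite inclE => /subvs_inj->.
Qed.

Lemma fac_hom0 M X T (f : 'Hom(X, T)) :
  trace M X = fullv -> (forall g : 'Hom(M, T), Alin g -> g = 0) ->
  Alin f -> f = 0.
Proof.
move=> tX MT0 fA; have: (trace M X <= lker f)%VS.
  apply: trace_sub => g gA; rewrite lkerE -limg_comp.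
  by rewrite (MT0 (f \o g)%VF) ?lim0g //; apply: Alin_comp.
by rewrite tX => /subvP ker_f; apply/lfunP => x; rewrite zero_lfunE;
  apply/eqP; rewrite -memv_ker ker_f ?memvf.
Qed.

Lemma fac_hom_neq0 M X : trace M X = fullv -> ~ is_zero X ->
  exists2 f : 'Hom(M, X), Alin f & f != 0.
Proof.
move=> tX X0; apply: NNPP => no_f; apply: X0 => x.
have: \1%VF = 0 :> 'End(X).
  apply: fac_hom0 tX _ (@Alin_id _ _ X) => f fA.
  by apply/eqP; apply/negP => /negP f0; apply: no_f; exists f.
by move/lfunP/(_ x); rewrite id_lfunE zero_lfunE.
Qed.

Lemma vs_zeroP X : reflect (is_zero X) (fullv == 0%VS :> {vspace X}).
Proof.
apply: (iffP eqP) => [X0 x|X0].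
  by apply/eqP; rewrite -memv0 -X0 memvf.
by apply/vspaceP => x; rewrite (X0 x) !mem0v.
Qed.

End Trace.

(** * Maps from projectives and their dimension *)

Section HomDim.

Variables (K : fieldType) (A : falgType K).
Implicit Types M N P X Y Z T : rmod A.

Definition lcomp (U V W : vectType K) (g : 'Hom(V, W)) :
    'Hom('Hom(U, V), 'Hom(U, W)) :=
  linfun (fun f : 'Hom(U, V) => (g \o f)%VF).

Lemma lcompE (U V W : vectType K) (g : 'Hom(V, W)) (f : 'Hom(U, V)) :
  lcomp U g f = (g \o f)%VF.
Proof.
rewrite linfunE // => k f1 f2; apply/lfunP => x.
by rewrite lfunLE !comp_lfunE lfunLE linearP.
Qed.

Definition rcomp (U V W : vectType K) (f : 'Hom(U, V)) :
    'Hom('Hom(V, W), 'Hom(U, W)) :=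
  linfun (fun g : 'Hom(V, W) => (g \o f)%VF).

Lemma rcompE (U V W : vectType K) (f : 'Hom(U, V)) (g : 'Hom(V, W)) :
  rcomp W f g = (g \o f)%VF.
Proof.
rewrite linfunE // => k f1 f2; apply/lfunP => x.
by rewrite lfunLE !comp_lfunE lfunLE.
Qed.

(** Projectivity applied to the surjection from [U] onto its image under [g]. *)
Lemma proj_lift P X Y (g : 'Hom(X, Y)) (U : {vspace X}) (f : 'Hom(P, Y)) :
  projective P -> Alin g -> submod U -> Alin f -> (limg f <= g @: U)%VS ->
  exists h : 'Hom(P, X), [/\ Alin h, (limg h <= U)%VS & (g \o h)%VF = f].
Proof.
move=> projP gA sU fA fU; have sV := submod_limg gA sU.
pose X' := rsub sU; pose Y' := rsub sV.
pose g1 : 'Hom(X', Y) := (g \o incl U)%VF.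
have g1V : (limg g1 <= g @: U)%VS.
  by apply/subvP => _ /memv_imgP[u _ ->];
    rewrite comp_lfunE inclE memv_img ?subvsP.
have g1A : @Alin _ _ X' Y g1 by apply: Alin_comp => //; apply: Alin_incl.
have /homAP g'A : @Alin _ _ X' Y' (corestr _ g1) by apply: Alin_corestr.
have /homAP f'A : @Alin _ _ P Y' (corestr _ f) by apply: Alin_corestr.
have [] := projP X' Y' (Subvs g'A) (Subvs f'A).
  apply/vspaceP => y; rewrite memvf.
  have /memv_imgP[u uU yE] := subvsP y.
  apply/memv_imgP; exists (Subvs uU); rewrite ?memvf //.
  apply: subvs_inj; rewrite corestrE ?comp_lfunE ?inclE //.
  by rewrite -yE subvsP.
move=> h /(congr1 vsval) /= hE; exists (incl U \o vsval h)%VF; split.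
- by apply: (@Alin_comp _ _ P X' X); [apply/homAP/subvsP | apply: Alin_incl].
- by apply/subvP => _ /memv_imgP[x _ ->]; rewrite comp_lfunE inclE subvsP.
apply/lfunP => x; have fx : f x \in (g @: U)%VS.
  by apply: (subvP fU); rewrite memv_img ?memvf.
rewrite -(corestrE fx) -hE [in RHS]comp_lfunE.
transitivity (g1 (vsval h x)); first by rewrite !comp_lfunE.
have gV : g1 (vsval h x) \in (g @: U)%VS.
  by rewrite (subvP g1V) ?memv_img ?memvf.
exact/esym/(corestrE gV).
Qed.

(** This is Hom ([P], [U]) kept inside Hom ([P], [X]), so that submodules of [X] can be compared in
    one ambient space. *)
Definition homS P X (U : {vspace X}) : {vspace 'Hom(P, X)} :=
  (homA P X :&: lker (lcomp P (\1 - projv U)%VF))%VS.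

Lemma homSP P X (U : {vspace X}) (f : 'Hom(P, X)) :
  reflect (Alin f /\ (limg f <= U)%VS) (f \in homS P U).
Proof.
rewrite memv_cap memv_ker lcompE; apply: (iffP andP) => -[/homAP fA fU];
  split=> //.
  apply/subvP => _ /memv_imgP[x _ ->]; rewrite -memv_compl_projv memv_ker.
  by rewrite -comp_lfunE (eqP fU) zero_lfunE.
apply/eqP/lfunP => x; rewrite zero_lfunE comp_lfunE; apply/eqP.
by rewrite -memv_ker memv_compl_projv (subvP fU) ?memv_img ?memvf.
Qed.

Lemma homSf P X : homS P (fullv : {vspace X}) = homA P X.
Proof.
apply/vspaceP => f; apply/homSP/homAP => [[]//|fA]; split=> //; exact: subvf.
Qed.

(** Rank-nullity for composition with [f] on Hom ([P], [U]); projectivity of [P] identifies the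
    image. *)
Lemma homS_dim P X Y (f : 'Hom(X, Y)) (U : {vspace X}) :
  projective P -> Alin f -> submod U ->
  (\dim (homS P (U :&: lker f)) + \dim (homS P (f @: U)) = \dim (homS P U))%N.
Proof.
move=> projP fA sU; rewrite -(limg_ker_dim (lcomp P f) (homS P U)).
congr addn; congr dimv; apply/vspaceP => g.
  apply/homSP/memv_capP => [[gA gU]|[/homSP[gA gU]]].
    split; first by apply/homSP; split=> //; apply: subv_trans gU (capvSl _ _).
    rewrite memv_ker lcompE; apply/eqP/lfunP => x;
      rewrite comp_lfunE zero_lfunE.
    apply/eqP; rewrite -memv_ker (subvP (capvSr U _)) // (subvP gU) //.
    by rewrite memv_img ?memvf.
  rewrite memv_ker lcompE => /eqP fg0; split=> //.
  by rewrite subv_cap gU lkerE -limg_comp fg0 lim0g eqxx.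
apply/homSP/memv_imgP => [[gA gU]|[h /homSP[hA hU] ->]].
  have [h [hA hU <-]] := proj_lift projP fA sU gA gU.
  by exists h; rewrite ?lcompE //; apply/homSP.
by rewrite lcompE; split; [apply: Alin_comp | rewrite limg_comp limgS].
Qed.

End HomDim.

(** * Fac [M] and the g-vector *)

Section FacCriterion.

Variables (K : fieldType) (A : falgType K).
Implicit Types M N P X Y Z T : rmod A.

Lemma factor_epi X Y Z (g : 'Hom(X, Y)) (w : 'Hom(X, Z)) :
  Alin g -> limg g = fullv -> Alin w -> (lker g <= lker w)%VS ->
  exists2 v : 'Hom(Y, Z), Alin v & (v \o g)%VF = w.
Proof.
move=> gA g_surj wA /subvP ker_gw; pose v := (w \o g^-1)%VF.
have gV y : g (g^-1%VF y) = y by apply: limg_lfunVK; rewrite g_surj memvf.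
have vg x : v (g x) = w x.
  apply/eqP; rewrite comp_lfunE -subr_eq0 -linearB -memv_ker ker_gw //.
  by rewrite memv_ker linearB /= gV subrr.
exists v; last by apply/lfunP => x; rewrite comp_lfunE vg.
by move=> y a; rewrite -[y]gV -gA !vg wA.
Qed.

(* When the presentation is minimal, surjectivity of [Hom (f, Y)] for every [Y]
   in Fac [M] means [Hom (M, tau M) = 0]; unlike minimality, the condition
   makes sense for any presentation and is easily seen to pass to direct
   summands. *)
Definition rigid_presentation P1 P0 M (f : 'Hom(P1, P0)) (g : 'Hom(P0, M)) :=
  [/\ projective P1 /\ projective P0, Alin f /\ Alin g,
      limg g = fullv, limg f = lker g
    & forall Y (u : 'Hom(P1, Y)), trace M Y = fullv -> Alin u ->
        exists2 w : 'Hom(P0, Y), Alin w & (w \o f)%VF = u].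

Definition presented_rigid M : Prop :=
  exists P1 P0 (f : 'Hom(P1, P0)) (g : 'Hom(P0, M)), rigid_presentation f g.

Definition hdim P X (U : {vspace X}) : int := (\dim (homS P U))%:Z.

(* The value of the g-vector [P0] - [P1] on the dimension vector of [U]. *)
Definition gval P1 P0 X (U : {vspace X}) : int := hdim P0 U - hdim P1 U.

Lemma gval_quo P1 P0 X (U : {vspace X}) (sU : submod U) :
  projective P1 -> projective P0 ->
  gval P1 P0 (fullv : {vspace X}) - gval P1 P0 U
    = (\dim (homA P0 (rquo sU)))%:Z - (\dim (homA P1 (rquo sU)))%:Z.
Proof.
have dimE P : projective P -> hdim P (fullv : {vspace X})
    = hdim P U + (\dim (homA P (rquo sU)))%:Z.
  move=> projP; rewrite /hdim -(homS_dim projP (Alin_quo sU) (@submodf _ _ X)).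
  rewrite capfv lker_quo limg_quo -[fullv]/(fullv : {vspace rquo sU}).
  by rewrite homSf PoszD.
move=> proj1 proj0; rewrite /gval !dimE //; ring.
Qed.

Section Presentation.

Variables (P1 P0 M : rmod A) (f : 'Hom(P1, P0)) (g : 'Hom(P0, M)).
Hypothesis pres : rigid_presentation f g.

(** By rigidity 0 -> Hom (M, Y) -> Hom (P0, Y) -> Hom (P1, Y) -> 0 is exact, and Hom (M, Y) is
    nonzero. *)
Lemma fac_dim_lt Y : trace M Y = fullv -> ~ is_zero Y ->
  (\dim (homA P1 Y) < \dim (homA P0 Y))%N.
Proof.
case: pres => _ [fA gA] g_surj f_ker f_rigid tY Y0.
rewrite -(limg_ker_dim (rcomp Y f) (homA P0 Y)).
have <- : (rcomp Y f @: homA P0 Y)%VS = homA P1 Y.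
  apply/vspaceP => u; apply/memv_imgP/homAP => [[w /homAP wA ->]|uA].
    by rewrite rcompE; apply: Alin_comp.
  by have [w /homAP wA <-] := f_rigid Y u tY uA; exists w; rewrite ?rcompE.
rewrite -[X in (X < _)%N]add0n ltn_add2r lt0n dimv_eq0.
have [h hA h0] := fac_hom_neq0 tY Y0; apply: contraNneq h0 => ker0.
suff : (h \o g)%VF = 0.
  move=> hg0; apply/eqP/lfunP => x.
  have /memv_imgP[y _ ->] : x \in limg g by rewrite g_surj memvf.
  by rewrite -comp_lfunE hg0 !zero_lfunE.
apply/eqP; rewrite -memv0 -ker0 memv_cap memv_ker rcompE.
apply/andP; split; first by apply/homAP/Alin_comp.
apply/eqP/lfunP => x; rewrite !comp_lfunE zero_lfunE.
have /eqP-> : g (f x) == 0 by rewrite -memv_ker -f_ker memv_img ?memvf.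
by rewrite linear0.
Qed.

(** By left exactness Hom (P0, Y) now embeds into Hom (P1, Y). *)
Lemma torsionfree_dim_le Y : homA M Y = 0%VS ->
  (\dim (homA P0 Y) <= \dim (homA P1 Y))%N.
Proof.
case: pres => _ [fA gA] g_surj f_ker _ MY0.
have <- : \dim (rcomp Y f @: homA P0 Y) = \dim (homA P0 Y).
  apply: limg_dim_eq; apply/eqP; rewrite -subv0; apply/subvP => w.
  rewrite memv_cap memv_ker rcompE => /andP[/homAP wA /eqP wf0].
  have [|v /homAP vA <-] := factor_epi gA g_surj wA.
    by rewrite -f_ker lkerE -limg_comp wf0 lim0g.
  have /eqP-> : v == 0 by rewrite -memv0 -MY0.
  by rewrite comp_lfun0l mem0v.
apply/dimvS/subvP => _ /memv_imgP[w /homAP wA ->].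
by rewrite rcompE; apply/homAP/Alin_comp.
Qed.

(** So the trace is the torsion part of [X]: rigidity lets a map from [M] to the quotient lift to
    [X], where its image lies in the trace. *)
Lemma hom_quo_trace X : homA M (rquo (@submod_trace _ _ M X)) = 0%VS.
Proof.
case: pres => [[proj1 proj0]] [fA gA] g_surj f_ker f_rigid.
set sT := @submod_trace _ _ M X; set Q := rquo sT.
have piA : Alin (quo_map _ : 'Hom(X, Q)) := Alin_quo sT.
apply/eqP; rewrite -subv0; apply/subvP => h /homAP hA.
(* [k] lifts [h \o g] to [X]; on the image of [f] its values lie in the trace. *)
have [|k [kA _ kE]] := proj_lift proj0 piA (@submodf _ _ X) (Alin_comp gA hA).
  by rewrite limg_quo subvf.
have kfT : (limg (k \o f) <= trace M X)%VS.
  rewrite limg_comp -[Z in (_ <= Z)%VS](lker_quo (trace M X)) lkerE.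
  rewrite -limg_comp kE limg_comp f_ker.
  have -> : (g @: lker g = 0)%VS by apply/eqP; rewrite -lkerE.
  by rewrite limg0.
(* The trace lies in Fac [M], so rigidity gives a map [w] into it that agrees with [k] on the image
   of [f]. *)
have [|w wA wE] := f_rigid (rsub sT) (corestr _ (k \o f)%VF) (fac_trace M X).
  by apply: Alin_corestr => //; apply: Alin_comp.
pose w' : 'Hom(P0, X) := (incl (trace M X) \o w)%VF.
have w'A : Alin w' := Alin_comp wA (@Alin_incl _ _ X _ sT).
(* The difference of [k] and [w'] vanishes on [lker g], so it comes from a map [v] on [M]. *)
have [|v vA vE] := factor_epi gA g_surj (AlinB kA w'A).
  rewrite -f_ker; apply/subvP => _ /memv_imgP[x _ ->].
  rewrite memv_ker add_lfunE opp_lfunE subr_eq0; apply/eqP.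
  have kfx : (k \o f)%VF x \in trace M X.
    by rewrite (subvP kfT) ?memv_img ?memvf.
  transitivity (vsval (corestr (trace M X) (k \o f)%VF x)).
    by rewrite (corestrE kfx) comp_lfunE.
  by rewrite -wE !comp_lfunE inclE.
rewrite memv0; apply/eqP/lfunP => m; rewrite zero_lfunE.
have /memv_imgP[p _ ->] : m \in limg g by rewrite g_surj memvf.
have piT x : x \in trace M X -> quo_map (trace M X) x = 0.
  by rewrite -{1}(lker_quo (trace M X)) memv_ker => /eqP.
have vgT : v (g p) \in trace M X.
  by rewrite (subvP (limg_trace vA)) // memv_img ?memvf.
rewrite -comp_lfunE -kE comp_lfunE.
have -> : k p = v (g p) + w' p.
  by rewrite -comp_lfunE vE add_lfunE opp_lfunE subrK.
by rewrite piT // memvD // comp_lfunE inclE subvsP.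
Qed.

(** Quotients of modules in Fac [M] stay in Fac [M], where [fac_dim_lt] applies; if the trace is
    proper, the quotient by it receives no nonzero map from [M] and violates the inequality. *)
Lemma facP X :
  trace M X = fullv <->
  forall U : {vspace X}, submod U -> U <> fullv ->
    0 < gval P1 P0 (fullv : {vspace X}) - gval P1 P0 U.
Proof.
have [[proj1 proj0] _ _ _ _] := pres; split=> [tX U sU U_neq|gpos].
  rewrite (gval_quo sU) // subr_gt0 ltz_nat; apply: fac_dim_lt.
    exact: fac_quotient (Alin_quo sU) (limg_quo _) tX.
  move=> Q0; apply: U_neq; apply: subv_anti; rewrite subvf /=.
  by apply/subvP => x _; rewrite -(lker_quo U) memv_ker (Q0 (quo_map U x)).
apply: NNPP => tX; have := gpos _ (@submod_trace _ _ M X) tX.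
rewrite (gval_quo (@submod_trace _ _ M X)) // subr_gt0 ltz_nat ltnNge.
rewrite torsionfree_dim_le //.
exact: hom_quo_trace.
Qed.

End Presentation.

End FacCriterion.

(** * Composition factors and bricks *)

Section CompositionSeries.

Variables (K : fieldType) (A : falgType K).
Implicit Types M N P X Y Z T : rmod A.

Lemma exists_cover X (V : {vspace X}) : submod V -> V <> fullv ->
  exists W : {vspace X}, covers V W.
Proof.
move=> sV V_neq; pose Q (W : {vspace X}) := [/\ submod W, (V <= W)%VS & W <> V].
have Qf : Q fullv by split; [apply: submodf | apply: subvf | apply: nesym].
have [W [sW leVW W_neq] minW] := argminP (fun W => \dim W) Qf.
exists W; split=> //; first exact: nesym.
move=> Z sZ leVZ leZW; have [-> | /eqP Z_neq] := eqVneq Z V; first by left.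
by right; apply/eqP; rewrite eqEdim leZW minW.
Qed.

Lemma series_from X (V : {vspace X}) : submod V ->
  exists l (U : nat -> {vspace X}), [/\ U 0%N = V, U l = fullv &
    forall i, (i < l)%N -> covers (U i) (U i.+1)].
Proof.
have [d] := ubnP (\dim {:X} - \dim V); elim: d V => // d IHd V /ltnSE leVd sV.
have [->|/eqP V_neq] := eqVneq V fullv; first by exists 0%N, (fun=> fullv).
have [W covVW] := exists_cover sV V_neq; have [_ sW leVW VW _] := covVW.
have ltVW : (\dim V < \dim W)%N.
  by rewrite ltnNge; apply/negP => leWV; apply/VW/eqP; rewrite eqEdim leVW.
have [|//|l [U [U0 Ul covU]]] := IHd W.
  by apply: leq_trans leVd; rewrite ltn_sub2l // (leq_trans ltVW) ?dimvS ?subvf.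
exists l.+1, (fun i => if i is i'.+1 then U i' else V).
by split=> // -[|i] ltil; [rewrite U0 | apply: covU].
Qed.

Lemma exists_length X : exists l, has_length X l.
Proof. by have [l [U hU]] := series_from (@submod0 _ _ X); exists l, U. Qed.

(** * Composition factors measured against a fixed series of the algebra *)

Section Jumps.

Variables (n : nat) (C : nat -> {vspace regular A}).
Hypotheses (C0 : C 0%N = 0%VS) (Cn : C n = fullv).
Hypothesis covC : forall i, (i < n)%N -> covers (C i) (C i.+1).

(* [V' / V], being simple, is generated by one element, hence isomorphic to
   some composition factor [C i.+1 / C i] of [A]; as [V' + U] is either
   [V + U] or has the same quotient over it, the list [s] has at most one
   element. *)
Lemma cover_jump X (V V' U : {vspace X}) : covers V V' -> submod U ->
  exists2 s : seq 'I_n, (size s <= 1)%N & forall P, projective P ->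
    hdim P (V' + U)%VS
      = hdim P (V + U)%VS + \sum_(i <- s) (hdim P (C i.+1) - hdim P (C i)).
Proof.
move=> [sV sV' leVV' _ midV] sU; have sW := submodD sV sU.
set W := (V + U)%VS in sW *.
have leVW : (V <= W)%VS by apply: addvSl.
have [leV'W|/subvPn[y yV' yW]] := boolP (V' <= W)%VS.
  exists [::] => // P _; rewrite big_nil addr0; congr (hdim P _).
  by apply: subv_anti; rewrite subv_add leV'W addvSr addvS.
pose moves i := ~~ (ractl y @: C i <= W)%VS.
have moves_n : moves n.
  apply/negP => /subvP yAW; move: yW; rewrite -(ract1 y) -ractlE.
  by rewrite yAW // memv_img // Cn memvf.
(* The least index whose image under [ractl y] leaves [W]; it is positive since [C 0] is zero, and
   the factor sought lies just below it. *)
have [[|i] yD min_i] := ex_minnP (ex_intro _ n moves_n).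
  by case/negP: yD; rewrite C0 limg0 sub0v.
have lt_in : (i < n)%N by apply: min_i.
have yC : (ractl y @: C i <= W)%VS.
  by apply: contraT => /min_i; rewrite ltnn.
have [sC sD leCD _ midC] := covC lt_in; set D := C i.+1 in yD sD leCD midC.
have yA : @Alin _ _ (regular A) X (ractl y) := Alin_ractl y.
have sYD : submod (ractl y @: D)%VS := submod_limg yA sD.
have V'E : V' = (V + ractl y @: D)%VS.
  have [|||E|//] := midV (V + ractl y @: D)%VS.
  - exact: submodD.
  - exact: addvSl.
  - rewrite subv_add leVV'; apply/subvP => _ /memv_imgP[a _ ->].
    by rewrite ractlE; apply: sV'.
  by case/negP: yD; apply: subv_trans leVW; rewrite -[X in (_ <= X)%VS]E addvSr.
pose q : 'Hom(X, rquo sW) := quo_map W.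
pose phi : 'Hom(regular A, rquo sW) := (q \o ractl y)%VF.
have qA : Alin q := Alin_quo sW.
have phiA : Alin phi := Alin_comp yA qA.
have kerq : lker q = W := lker_quo W.
have kerphi (Z : {vspace regular A}) :
    (Z <= lker phi)%VS = (ractl y @: Z <= W)%VS.
  by rewrite lkerE limg_comp -lkerE kerq.
(* [phi] kills [C i] but not [D], and [D / C i] is simple. *)
have CE : (D :&: lker phi)%VS = C i.
  have [||||/capv_idPl E] := midC (D :&: lker phi)%VS; rewrite ?capvSl //.
  - by apply: submodI => //; apply: submod_ker.
  - by rewrite subv_cap leCD kerphi.
  by case/negP: yD; rewrite -kerphi.
have W'E : (V' + U)%VS = (ractl y @: D + W)%VS.
  by rewrite V'E /W addvA [(_ + V)%VS]addvC.
exists [:: Ordinal lt_in] => // P projP; rewrite big_seq1 /hdim /=.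
(* Exactness of Hom (P, -) turns both differences into the dimension of the maps into the image of
   [D] under [phi]. *)
rewrite -/D -(homS_dim projP phiA sD) CE W'E.
rewrite -(homS_dim projP qA (submodD sYD sW)) kerq.
have -> : ((ractl y @: D + W) :&: W = W)%VS by apply/capv_idPr/addvSr.
have -> : (q @: (ractl y @: D + W) = phi @: D)%VS.
  have /eqP qW0 : (q @: W == 0)%VS by rewrite -lkerE kerq.
  by rewrite limgD -limg_comp qW0 addv0.
rewrite !PoszD; ring.
Qed.

Lemma series_jumps X (V : nat -> {vspace X}) l (U : {vspace X}) :
  (forall i, (i < l)%N -> covers (V i) (V i.+1)) -> submod U ->
  exists2 s : seq 'I_n, (size s <= l)%N & forall P, projective P ->
    hdim P (V l + U)%VS
      = hdim P (V 0%N + U)%VS + \sum_(i <- s) (hdim P (C i.+1) - hdim P (C i)).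
Proof.
move=> + sU; elim: l => [|l IHl] covV.
  by exists [::] => // P _; rewrite big_nil addr0.
have [i /ltnW ltil|s le_s sE] := IHl; first exact: covV.
have [t le_t tE] := cover_jump (covV l (ltnSn l)) sU.
exists (s ++ t) => [|P projP]; first by rewrite size_cat -addn1 leq_add.
by rewrite big_cat tE // sE // addrA.
Qed.

(** For projective [P1] and [P0], the value of the g-vector on the simple module [C i.+1 / C i]. *)
Definition jump P1 P0 (i : 'I_n) : int :=
  gval P1 P0 (C i.+1) - gval P1 P0 (C i).

(* All that matters of the g-vector of a presentation: its signs on the
   (finitely many) dimension vectors of modules of length at most [b]. *)
Definition gsigns b P1 P0 : {ffun b.-bseq 'I_n -> bool} :=
  [ffun s : b.-bseq 'I_n => 0 < \sum_(i <- s) jump P1 P0 i].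

(** The list [s] of composition factors of [X / U] is chosen before [P1] and [P0], so one list
    serves all presentations. *)
Lemma gval_quo_signs b X l (U : {vspace X}) :
  has_length X l -> (l <= b)%N -> submod U ->
  exists s : b.-bseq 'I_n, forall P1 P0, projective P1 -> projective P0 ->
    (0 < gval P1 P0 (fullv : {vspace X}) - gval P1 P0 U) = gsigns b P1 P0 s.
Proof.
move=> [V [V0 Vl covV]] le_lb sU; have [s le_s sE] := series_jumps covV sU.
exists (Bseq (leq_trans le_s le_lb)) => P1 P0 proj1 proj0; rewrite ffunE.
have dimE P : projective P -> hdim P (fullv : {vspace X})
    = hdim P U + \sum_(i <- s) (hdim P (C i.+1) - hdim P (C i)).
  by move/sE; rewrite Vl V0 add0v (addv_idPl (subvf U)).
congr (0 < _); rewrite /gval !dimE //=.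
transitivity (\sum_(i <- s) ((hdim P0 (C i.+1) - hdim P0 (C i))
                           - (hdim P1 (C i.+1) - hdim P1 (C i)))).
  by rewrite [in RHS]sumrB; ring.
by apply: eq_bigr => i _; rewrite /jump /gval !opprD addrACA.
Qed.

Lemma fac_gsigns b M P1 P0 (f : 'Hom(P1, P0)) (g : 'Hom(P0, M))
    M' (P1' P0' : rmod A) (f' : 'Hom(P1', P0')) (g' : 'Hom(P0', M')) X l :
  rigid_presentation f g -> rigid_presentation f' g' ->
  gsigns b P1 P0 = gsigns b P1' P0' -> has_length X l -> (l <= b)%N ->
  trace M X = fullv -> trace M' X = fullv.
Proof.
move=> pres pres' sgE lenX le_lb /(facP pres) posX.
apply/(facP pres') => U sU U_neq; have := posX U sU U_neq.
have [[proj1 proj0] _ _ _ _] := pres; have [[proj1' proj0'] _ _ _ _] := pres'.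
by have [s sE] := gval_quo_signs lenX le_lb sU; rewrite !sE // sgE.
Qed.

End Jumps.

Lemma fac_bricks M M' : presented_rigid M' ->
  (forall B, brick B -> trace M B = fullv -> trace M' B = fullv) ->
  forall X, trace M X = fullv -> trace M' X = fullv.
Proof.
move=> [P1 [P0 [f [g pres]]]] bricksM X0 tX0; apply: NNPP => tX0'.
pose Q X := trace M X = fullv /\ trace M' X <> fullv.
have [X [tX tX'] minX] := argminP (fun X => \dim {:X}) (conj tX0 tX0' : Q X0).
(* A proper quotient of [X] stays in Fac [M], so by minimality it lies in Fac [M']. *)
have smaller Y (h : 'Hom(X, Y)) : Alin h -> limg h = fullv -> lker h <> 0%VS ->
    trace M' Y = fullv.
  move=> hA h_surj h_ker; apply: NNPP => tY'.
  have := minX Y (conj (fac_quotient hA h_surj tX) tY').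
  rewrite -(limg_ker_dim h fullv) h_surj capfv -[X in (_ <= X)%N]add0n.
  by rewrite leq_add2r leqn0 dimv_eq0 => /eqP.
(* Otherwise the quotient by the trace would lie in Fac [M'] while receiving no nonzero map from
   [M'], hence vanish. *)
have tX'0 : trace M' X = 0%VS.
  apply: NNPP => tX'0; apply: tX'; set sT := @submod_trace _ _ M' X.
  have kerq : lker (quo_map _ : 'Hom(X, rquo sT)) = trace M' X := lker_quo _.
  have := smaller _ _ (Alin_quo sT) (limg_quo _); rewrite kerq => /(_ tX'0) tQ.
  apply: subv_anti; rewrite subvf; apply/subvP => x _.
  rewrite -kerq memv_ker -memv0.
  have le0 : (trace M' (rquo sT) <= 0)%VS.
    apply: trace_sub => h /homAP.
    by rewrite (hom_quo_trace pres) memv0 => /eqP->; rewrite lim0g sub0v.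
  by apply: (subvP le0); rewrite tQ; apply: memvf.
have homX0 (h : 'Hom(M', X)) : Alin h -> h = 0.
  move=> hA; apply/lfunP => x; rewrite zero_lfunE; apply/eqP.
  by rewrite -memv0 -tX'0 (subvP (limg_trace hA)) // memv_img ?memvf.
apply: (tX'); apply: bricksM tX; split=> [X00|h /homAP hA h0].
  by apply: tX'; rewrite tX'0; apply/esym/eqP/vs_zeroP.
(* Otherwise the image of [h] is a proper quotient, hence in Fac [M']; but it embeds in [X], which
   receives no nonzero map from [M']. *)
have ker_h : lker h = 0%VS.
  apply: NNPP => ker_h; case/eqP: h0.
  pose I := rsub (submod_limg hA (@submodf _ _ X)).
  pose h' : 'Hom(X, I) := corestr (limg h) h.
  have h'E x : vsval (h' x) = h x by apply: corestrE; rewrite memv_img ?memvf.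
  have tI : trace M' I = fullv.
    apply: (smaller I h').
    - exact: Alin_corestr.
    - apply/vspaceP => y; rewrite memvf; have /memv_imgP[x _ yE] := subvsP y.
      by apply/memv_imgP; exists x; rewrite ?memvf //; apply: val_inj;
        rewrite /= h'E.
    move=> ker_h'; apply: ker_h; apply/vspaceP => x.
    by rewrite -ker_h' !memv_ker -(inj_eq (@subvs_inj _ _ _)) h'E linear0.
  have incl0 := fac_hom0 tI homX0 (@Alin_incl _ _ X _ _).
  by apply/lfunP => x; rewrite zero_lfunE -h'E -inclE incl0 zero_lfunE.
have [hVA hVh hhV] := Alin_endo_inv hA ker_h.
by exists (h^-1)%VF => //; apply/homAP.
Qed.

End CompositionSeries.

(** * Rigid presentations *)

Section Rigid.

Variables (K : fieldType) (A : falgType K).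
Implicit Types M N P X Y Z T : rmod A.

(** * Free modules, dual bases and the Nakayama pairing *)

Section Free.

Variable n : nat.
Let F := {ffun 'I_n -> A}.
Let actF (x : F) (a : A) : F := [ffun i => x i * a].

Fact actF_linearl a : linear (actF^~ a).
Proof. by move=> k x y; apply/ffunP => i; rewrite !ffunE mulrDl scalerAl. Qed.

Fact actF_linearr x : linear (actF x).
Proof. by move=> k a b; apply/ffunP => i; rewrite !ffunE mulrDr scalerAr. Qed.

Fact actF1 x : actF x 1 = x.
Proof. by apply/ffunP => i; rewrite !ffunE mulr1. Qed.

Fact actFM x a b : actF x (a * b) = actF (actF x a) b.
Proof. by apply/ffunP => i; rewrite !ffunE mulrA. Qed.

Definition rfree : rmod A := RMod actF_linearl actF_linearr actF1 actFM.

End Free.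

(** A surjection from a free module onto [P] splits; [h] consists of the coordinates of the
    splitting. *)
Lemma dual_basis P : projective P ->
  exists n (p : 'I_n -> P) (h : 'I_n -> 'Hom(P, regular A)),
    (forall i, Alin (h i)) /\ forall x, x = \sum_i ract (p i) (h i x).
Proof.
move=> projP; pose n := \dim {:P}; pose p i := (vbasis {:P})`_i : P.
pose F := rfree n.
pose e : 'Hom(F, P) :=
  linfun (fun x : F => \sum_(i < n) ract (p i) ((x : {ffun _ -> _}) i)).
have eE (x : F) : e x = \sum_(i < n) ract (p i) ((x : {ffun _ -> _}) i).
  rewrite linfunE // => k u v; rewrite scaler_sumr -big_split.
  by apply: eq_bigr => i _; rewrite !ffunE ract_linearr.
have eA : Alin e.
  move=> x a; rewrite !eE ract_sum; apply: eq_bigr => i _.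
  by rewrite ffunE ractM.
have e_surj : limg e = fullv.
  apply/vspaceP => x; rewrite memvf; apply/memv_imgP.
  exists [ffun i => (coord (vbasis {:P}) i x)%:A]; rewrite ?memvf // eE.
  rewrite {1}(coord_vbasis (memvf x)); apply: eq_bigr => i _.
  by rewrite ffunE -ractlE linearZ /= ractlE ract1.
have [|s [sA _ sE]] := proj_lift projP eA (@submodf _ _ F) (@Alin_id _ _ P).
  by rewrite e_surj subvf.
pose c i : 'Hom(F, regular A) := linfun (fun x : F => (x : {ffun _ -> _}) i).
have cE i (x : F) : c i x = (x : {ffun _ -> _}) i.
  by rewrite linfunE // => k u v; rewrite !ffunE.
have cA i : Alin (c i) by move=> x a; rewrite !cE ffunE.
exists n, p, (fun i => (c i \o s)%VF); split=> [i|x]; first exact: Alin_comp.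
rewrite -{1}[x]id_lfunE -sE comp_lfunE eE; apply: eq_bigr => i _.
by rewrite comp_lfunE cE.
Qed.

(* The natural isomorphism D Hom (P, Y) = Hom (Y, nu P), for a linear form
   [alpha] on all linear maps from [P] to [Y]. *)
Section NakayamaPairing.

Variables (P Y : rmod A) (alpha : 'Hom('Hom(P, Y), K^o)).

Let pair (y : Y) (h : Defs.hom P (regular A)) : 'Hom(P, Y) :=
  (ractl y \o vsval h)%VF.

Definition nakayama_pairing : 'Hom(Y, nakayama P) :=
  linfun (fun y : Y => linfun (fun h => alpha (pair y h))).

Lemma nakayama_pairingE (y : Y) (h : Defs.hom P (regular A)) :
  (nakayama_pairing y : 'Hom(_, _)) h = alpha (ractl y \o vsval h)%VF.
Proof.
have lin_h z : linear (fun h => alpha (pair z h)).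
  move=> k g1 g2; rewrite -linearP; congr (alpha _); apply/lfunP => x.
  by rewrite !(lfunLE, comp_lfunE) linearP.
rewrite linfunE; first by rewrite linfunE.
move=> k y1 y2; apply/lfunP => g; rewrite lfunLE !linfunE // -linearP.
congr (alpha _); apply/lfunP => x.
by rewrite !(lfunLE, comp_lfunE) !ractlE ract_linearl.
Qed.

Lemma Alin_nakayama_pairing : Alin nakayama_pairing.
Proof.
move=> y a; apply/lfunP => h; rewrite nakayama_actE !nakayama_pairingE.
congr (alpha _); apply/lfunP => x; rewrite !comp_lfunE !ractlE /=.
by rewrite lmulAE ractM.
Qed.

End NakayamaPairing.

(** One half of the Auslander-Reiten formula. If [u] does not factor through [f], a linear form
    killing the maps that do, but not [u], yields a map from [Y] to tau [M]. This map is zero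
    because [Y] lies in Fac [M], and then the form vanishes at [u]. *)
Lemma tau_rigid_presented M : tau_rigid M -> presented_rigid M.
Proof.
case=> T [P1 [P0 [f [g [[[proj1 proj0] g_surj f_ker _ _] isoT]]]]] MT0.
have fA : Alin (vsval f) by apply/homAP/subvsP.
have gA : Alin (vsval g) by apply/homAP/subvsP.
exists P1, P0, (vsval f), (vsval g); split=> // Y u tY uA.
suff /memv_imgP[w /homAP wA uE] :
    u \in (rcomp Y (vsval f) @: homA P0 Y)%VS by exists w; rewrite // uE rcompE.
apply: contraT => /separating_functional[alpha alpha0 alpha_u].
pose nu := nakayama_pairing alpha; pose R := rker (nakayama_map f).
(* [alpha] kills what factors through [f], so [nu] lands in the kernel that defines tau [M]. *)
have nu_ker : (limg nu <= lker (vsval (nakayama_map f)))%VS.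
  apply/subvP => _ /memv_imgP[y _ ->]; rewrite memv_ker; apply/eqP/lfunP => h.
  rewrite nakayama_funE nakayama_pairingE zero_lfunE; apply: alpha0.
  rewrite /= comp_lfunA -rcompE memv_img //;
    apply/homAP/(@Alin_comp _ _ P0 (regular A)).
    exact/homAP/subvsP.
  exact: Alin_ractl.
have nu'A : @Alin _ _ Y R (corestr _ nu).
  by apply: Alin_corestr => //; apply: Alin_nakayama_pairing.
have [a /homAP aA [b /homAP bA [ba ab]]] := isoT.
have bnu0 : (b \o corestr _ nu)%VF = 0.
  apply: fac_hom0 tY _ (Alin_comp nu'A bA) => h /homAP.
  by rewrite MT0 memv0 => /eqP.
have nu0 y : nu y = 0.
  rewrite -(@corestrE _ _ _ _ _ nu y (subvP nu_ker _ (memv_img nu (memvf y)))).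
  have -> : corestr _ nu y = (a \o (b \o corestr _ nu))%VF y.
    by rewrite comp_lfunA ab comp_lfun1l.
  by rewrite bnu0 comp_lfun0r zero_lfunE.
(* The dual basis writes [u] as a sum of maps through the regular module, on which [alpha] is given
   by values of [nu]. *)
case/eqP: alpha_u; have [n [p [h [hA pE]]]] := dual_basis proj1.
have -> : u = \sum_i (ractl (u (p i)) \o h i)%VF.
  apply/lfunP => x; rewrite {1}[x]pE linear_sum sum_lfunE.
  by apply: eq_bigr => i _; rewrite comp_lfunE ractlE; apply: uA.
rewrite linear_sum big1 // => i _; have /homAP hiA := hA i.
by have := nakayama_pairingE alpha (u (p i)) (Subvs hiA);
  rewrite -/nu nu0 zero_lfunE.
Qed.

(** * Retracts and summands of presentations *)

Definition retract X M (i : 'Hom(X, M)) (p : 'Hom(M, X)) : Prop :=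
  [/\ Alin i, Alin p & (p \o i)%VF = \1%VF].

Lemma retractK X M (i : 'Hom(X, M)) (p : 'Hom(M, X)) :
  retract i p -> cancel i p.
Proof. by case=> _ _ /lfunP pi x; rewrite -comp_lfunE pi id_lfunE. Qed.

Lemma projective_retract P X (i : 'Hom(X, P)) (p : 'Hom(P, X)) :
  projective P -> retract i p -> projective X.
Proof.
move=> projP [iA pA pi] M N g f g_surj.
have gA : Alin (vsval g) by apply/homAP/subvsP.
have fA : Alin (vsval f) by apply/homAP/subvsP.
have [|h [hA _ hE]] := proj_lift projP gA (@submodf _ _ M) (Alin_comp pA fA).
  by rewrite g_surj subvf.
have /homAP hiA := Alin_comp iA hA; exists (Subvs hiA).
by apply: val_inj; rewrite /= comp_lfunA hE -comp_lfunA pi comp_lfun1r.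
Qed.

(** [F] is injective on its image, hence bijective there by dimension; the retraction is [F]
    followed by the inverse of this bijection. *)
Lemma fitting_retract X (F : 'End(X)) (FA : Alin F)
    (I := rsub (submod_limg FA (@submodf _ _ X))) :
  (forall x, F (F x) = 0 -> F x = 0) ->
  exists2 p : 'Hom(X, I), retract (incl (limg F) : 'Hom(I, X)) p
    & lker p = lker F.
Proof.
move=> FF0; pose c : 'Hom(X, I) := corestr (limg F) F.
have cE x : vsval (c x) = F x by apply: corestrE; rewrite memv_img ?memvf.
have cA : Alin c by apply: Alin_corestr.
have inclA : @Alin _ _ I X (incl (limg F)) := @Alin_incl _ _ X _ _.
pose phi : 'End(I) := (c \o incl (limg F))%VF.
have phi_inj : lker phi = 0%VS.
  apply/eqP; rewrite -subv0; apply/subvP => y;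
    rewrite memv_ker comp_lfunE inclE.
  have /memv_imgP[x _ yE] := subvsP y.
  move/eqP/(congr1 vsval); rewrite cE yE linear0 => /FF0 Fx0.
  by rewrite memv0; apply/eqP/val_inj; rewrite /= yE Fx0.
have [phiVA phiVphi phiphiV] := Alin_endo_inv (Alin_comp inclA cA) phi_inj.
exists (phi^-1 \o c)%VF.
  by split=> //; [apply: Alin_comp | rewrite -comp_lfunA].
apply/vspaceP => x; rewrite !memv_ker comp_lfunE.
rewrite -(inj_eq (can_inj (lker0_lfunK (introT eqP phi_inj)))).
rewrite -[phi _]comp_lfunE phiphiV id_lfunE linear0.
by rewrite -(inj_eq (@subvs_inj _ _ _)) cE linear0.
Qed.


Lemma powlf_comm X Y (a : 'End(X)) (b : 'End(Y)) (f : 'Hom(X, Y)) n x :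
  (forall x, f (a x) = b (f x)) -> f (powlf a n x) = powlf b n (f x).
Proof. by move=> fab; rewrite !powlfE; elim: n => //= n <-. Qed.

(* The idempotent of [M] with image [X] lifts to an endomorphism of the
   presentation; by Fitting's lemma the image of a high power of the lift is a
   direct summand, and it presents [X]. *)
Lemma presented_retract X M (i : 'Hom(X, M)) (p : 'Hom(M, X)) :
  presented_rigid M -> retract i p -> presented_rigid X.
Proof.
move=> [P1 [P0 [f [g [[proj1 proj0] [fA gA] g_surj f_ker f_rigid]]]]] rXM.
have [iA pA _] := rXM; have iK := retractK rXM.
have gf x : g (f x) = 0.
  by apply/eqP; rewrite -memv_ker -f_ker memv_img ?memvf.
(* The idempotent [i \o p] lifts to [e0] on [P0], which in turn lifts to [e1] on [P1]. *)
have [|e0 [e0A _ e0E]] := proj_lift proj0 gA (@submodf _ _ P0)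
    (Alin_comp gA (Alin_comp pA iA)).
  by rewrite g_surj subvf.
have ge0 x : g (e0 x) = i (p (g x)).
  by rewrite -comp_lfunE e0E !comp_lfunE.
have [|e1 [e1A _ e1E]] := proj_lift proj1 fA (@submodf _ _ P1) (Alin_comp fA e0A).
  rewrite f_ker; apply/subvP => _ /memv_imgP[x _ ->].
  by rewrite memv_ker comp_lfunE ge0 gf !linear0.
have fe1 x : f (e1 x) = e0 (f x) by rewrite -comp_lfunE e1E comp_lfunE.
have [[m0 fit0] [m1 fit1]] := (fitting e0, fitting e1).
(* Beyond both Fitting bounds, and positive so that [F0] still lifts [i \o p]. *)
pose n := (m0 + m1).+1; pose F0 := powlf e0 n; pose F1 := powlf e1 n.
have F0A : Alin F0 := Alin_powlf n e0A.
have F1A : Alin F1 := Alin_powlf n e1A.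
have fF1 x : f (F1 x) = F0 (f x) by apply: powlf_comm.
have gF0 x : g (F0 x) = i (p (g x)).
  rewrite powlfE /n; elim: (m0 + m1)%N => [|k IHk]; first exact: ge0.
  by rewrite iterS ge0 IHk iK.
have FF0 x : F0 (F0 x) = 0 -> F0 x = 0.
  by apply: fit0; rewrite leqW ?leq_addr.
have FF1 x : F1 (F1 x) = 0 -> F1 x = 0.
  by apply: fit1; rewrite leqW ?leq_addl.
pose I0 := rsub (submod_limg F0A (@submodf _ _ P0)).
pose I1 := rsub (submod_limg F1A (@submodf _ _ P1)).
have [p0 r0 kerp0] := fitting_retract F0A FF0.
have [p1 r1 kerp1] := fitting_retract F1A FF1.
pose j0 : 'Hom(I0, P0) := incl (limg F0).
pose j1 : 'Hom(I1, P1) := incl (limg F1).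
have j0E (y : I0) : j0 y = vsval y by apply: inclE.
have j1E (y : I1) : j1 y = vsval y by apply: inclE.
have [j0A _ _] := r0; have [j1A _ _] := r1.
have fj1 y : f (j1 y) \in limg F0.
  have /memv_imgP[x _ yE] := subvsP y.
  by rewrite j1E yE fF1 memv_img ?memvf.
pose f' : 'Hom(I1, I0) := corestr (limg F0) (f \o j1)%VF.
have f'E y : j0 (f' y) = f (j1 y).
  by rewrite j0E -comp_lfunE; apply: corestrE; rewrite comp_lfunE fj1.
have f'A : Alin f'.
  apply: Alin_corestr; first exact: Alin_comp.
  by apply/subvP => _ /memv_imgP[y _ ->]; rewrite comp_lfunE fj1.
pose g' : 'Hom(I0, X) := (p \o (g \o j0))%VF.
have g'E y : g' y = p (g (j0 y)) by rewrite !comp_lfunE.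
have g'A : Alin g' by do 2![apply: Alin_comp => //].
have F0_lift x : exists y, j0 y = F0 x.
  have F0x := memv_img F0 (memvf x).
  by exists (Subvs F0x); rewrite j0E.
exists I1, I0, f', g'; split=> //.
- by split; [apply: projective_retract r1 | apply: projective_retract r0].
- apply/vspaceP => x; rewrite memvf.
  have /memv_imgP[q _ ix] : i x \in limg g by rewrite g_surj memvf.
  have [y yE] := F0_lift q; apply/memv_imgP; exists y; rewrite ?memvf //.
  by rewrite g'E yE gF0 -ix !iK.
- apply/vspaceP => y; apply/memv_imgP/idP => [[z _ ->]|].
    by rewrite memv_ker g'E f'E gf linear0.
  rewrite memv_ker g'E => /eqP pgy0.
  have [x _ yE] := memv_imgP (subvsP y).
  have gy : g (j0 y) = 0.
    by rewrite j0E yE gF0; move: pgy0; rewrite j0E yE gF0 iK => ->;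
      rewrite linear0.
  have /memv_imgP[s _ ys] : j0 y \in limg f by rewrite f_ker memv_ker gy.
  exists (p1 s); rewrite ?memvf // -[y](retractK r0) ys.
  (* [f] maps the kernel of [F1] into that of [F0], so [s] may be replaced by its component in
     [I1]. *)
  have s_ker : s - j1 (p1 s) \in lker F1.
    by rewrite -kerp1 memv_ker linearB /= (retractK r1) subrr.
  have fs_ker : f (s - j1 (p1 s)) \in lker p0.
    by rewrite kerp0 memv_ker -fF1; move: s_ker; rewrite memv_ker => /eqP->;
      rewrite linear0.
  move: fs_ker; rewrite memv_ker !linearB /= subr_eq0 => /eqP->.
  by rewrite -f'E (retractK r0).
move=> Y u tY uA.
have tMY := fac_trans pA _ tY.
(* [X] is a quotient of [M], so [Y] lies in Fac [M] and [u \o p1] extends along [f]; restricting to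
   [I0] gives the extension of [u]. *)
have [||w wA wE] := f_rigid Y (u \o p1)%VF.
- apply: fac_trans pA _ tY; apply/vspaceP => x; rewrite memvf -[x]iK.
  by rewrite memv_img ?memvf.
- by apply: Alin_comp uA; case: r1.
exists (w \o j0)%VF; first exact: Alin_comp.
apply/lfunP => y; rewrite comp_lfunE comp_lfunE f'E -comp_lfunE wE comp_lfunE.
by rewrite (retractK r1).
Qed.


End Rigid.

(** * Indecomposable modules *)

Section KrullSchmidt.

Variables (K : fieldType) (A : falgType K).
Implicit Types M N P X Y Z T : rmod A.

Lemma projective_presented P : projective P -> presented_rigid P.
Proof.
move=> projP; exists (rmod0 A), P, 0, \1%VF; split.
- split=> // M N g f _; have /homAP zA := @Alin0 _ _ (rmod0 A) M.
  exists (Subvs zA); apply: hom_eqP => x.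
  by rewrite [x]thinmx0 !linear0.
- by split; [apply: Alin0 | apply: Alin_id].
- by rewrite lim1g.
- by apply/vspaceP => x; rewrite lim0g memv0 memv_ker id_lfunE.
move=> Y u _ _; exists 0; first exact: Alin0.
by apply/lfunP => x; rewrite [x]thinmx0 !linear0.
Qed.

Lemma iso_bij M N (f : 'Hom(M, N)) :
  Alin f -> lker f = 0%VS -> limg f = fullv -> iso M N.
Proof.
move=> fA f_inj f_surj; have [fVA fVf ffV] := Alin_inv fA f_inj f_surj.
by exists f; [apply/homAP | exists (f^-1)%VF; [apply/homAP | ]].
Qed.

Lemma iso_refl M : iso M M.
Proof.
have idA : \1%VF \in homA M M by apply/homAP/Alin_id.
by exists \1%VF => //; exists \1%VF => //; rewrite comp_lfun1l.
Qed.

Lemma iso_sym M N : iso M N -> iso N M.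
Proof. by case=> f fA [g gA [gf fg]]; exists g => //; exists f. Qed.

Lemma iso_trans M N P : iso M N -> iso N P -> iso M P.
Proof.
move=> [f /homAP fA [g /homAP gA [gf fg]]].
move=> [f' /homAP f'A [g' /homAP g'A [gf' fg']]].
exists (f' \o f)%VF; first exact/homAP/(@Alin_comp _ _ M N P).
exists (g \o g')%VF; first exact/homAP/(@Alin_comp _ _ P N M).
rewrite -!comp_lfunA [(g' \o (f' \o f))%VF]comp_lfunA gf'.
by rewrite [(f \o (g \o g'))%VF]comp_lfunA fg !comp_lfun1l.
Qed.

Lemma iso_retract M N : iso M N ->
  exists (i : 'Hom(M, N)) (p : 'Hom(N, M)), retract i p.
Proof. by case=> f /homAP fA [g /homAP gA [gf _]]; exists f, g. Qed.

Lemma retract_trans X Y Z (i : 'Hom(X, Y)) p (j : 'Hom(Y, Z)) q :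
  retract i p -> retract j q -> retract (j \o i)%VF (p \o q)%VF.
Proof.
move=> rXY rYZ; have [iA pA _] := rXY; have [jA qA _] := rYZ.
split; [exact: Alin_comp | exact: Alin_comp |].
by apply/lfunP => x; rewrite !comp_lfunE (retractK rYZ) (retractK rXY) id_lfunE.
Qed.

(** * Direct sums and complements *)

Section DirectSumMaps.

Variables X Y : rmod A.

Definition dsum_fst : 'Hom(dsum X Y, X) := linfun (fun z : (X * Y)%type => z.1).
Definition dsum_snd : 'Hom(dsum X Y, Y) := linfun (fun z : (X * Y)%type => z.2).
Definition dsum_inl : 'Hom(X, dsum X Y) := linfun (fun x : X => (x, 0 : Y)).
Definition dsum_inr : 'Hom(Y, dsum X Y) := linfun (fun y : Y => (0 : X, y)).

Lemma dsum_fstE (z : (X * Y)%type) : dsum_fst z = z.1.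
Proof. by rewrite linfunE. Qed.

Lemma dsum_sndE (z : (X * Y)%type) : dsum_snd z = z.2.
Proof. by rewrite linfunE. Qed.

Lemma dsum_inlE (x : X) : dsum_inl x = (x, 0 : Y).
Proof. by rewrite linfunE // => k u v; congr pair;
  rewrite /= scaler0 addr0. Qed.

Lemma dsum_inrE (y : Y) : dsum_inr y = (0 : X, y).
Proof. by rewrite linfunE // => k u v; congr pair;
  rewrite /= scaler0 addr0. Qed.

Lemma retract_inl : retract dsum_inl dsum_fst.
Proof.
split=> [x a|z a|]; last by apply/lfunP => x;
  rewrite comp_lfunE dsum_inlE dsum_fstE id_lfunE.
  by rewrite !dsum_inlE; congr pair; rewrite ract0.
by rewrite !dsum_fstE.
Qed.

Lemma retract_inr : retract dsum_inr dsum_snd.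
Proof.
split=> [x a|z a|]; last by apply/lfunP => x;
  rewrite comp_lfunE dsum_inrE dsum_sndE id_lfunE.
  by rewrite !dsum_inrE; congr pair; rewrite ract0.
by rewrite !dsum_sndE.
Qed.

Definition dsum_pair Z (f : 'Hom(Z, X)) (g : 'Hom(Z, Y)) : 'Hom(Z, dsum X Y) :=
  ((dsum_inl \o f) + (dsum_inr \o g))%VF.

Lemma dsum_pairE Z (f : 'Hom(Z, X)) (g : 'Hom(Z, Y)) z :
  dsum_pair f g z = (f z, g z).
Proof.
rewrite add_lfunE !comp_lfunE dsum_inlE dsum_inrE.
by congr pair; rewrite ?addr0 ?add0r.
Qed.

Lemma Alin_pair Z (f : 'Hom(Z, X)) (g : 'Hom(Z, Y)) :
  Alin f -> Alin g -> Alin (dsum_pair f g).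
Proof. by move=> fA gA z a; rewrite !dsum_pairE fA gA. Qed.

End DirectSumMaps.

Lemma iso_dsum X X' Y Y' : iso X X' -> iso Y Y' -> iso (dsum X Y) (dsum X' Y').
Proof.
move=> [f /homAP fA [f' /homAP f'A [ff' f'f]]].
move=> [g /homAP gA [g' /homAP g'A [gg' g'g]]].
have [_ p1A _] := retract_inl X Y; have [_ p2A _] := retract_inr X Y.
have [_ q1A _] := retract_inl X' Y'; have [_ q2A _] := retract_inr X' Y'.
exists (dsum_pair (f \o dsum_fst X Y) (g \o dsum_snd X Y)).
  by apply/homAP/Alin_pair; apply: Alin_comp.
exists (dsum_pair (f' \o dsum_fst X' Y') (g' \o dsum_snd X' Y')).
  by apply/homAP/Alin_pair; apply: Alin_comp.
by split; apply/lfunP => -[x y];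
  rewrite comp_lfunE !dsum_pairE !comp_lfunE !dsum_fstE !dsum_sndE id_lfunE /=;
  rewrite -!comp_lfunE ?ff' ?gg' ?f'f ?g'g !id_lfunE.
Qed.

(** The complement is [lker p]. Its dimension serves an induction; being a retract, it inherits
    rigid presentations. *)
Lemma retract_iso_dsum X M (i : 'Hom(X, M)) (p : 'Hom(M, X)) :
  retract i p -> exists Y, [/\ iso M (dsum X Y), \dim {:Y} = \dim (lker p) &
    exists (j : 'Hom(Y, M)) (q : 'Hom(M, Y)), retract j q].
Proof.
move=> r; have [iA pA _] := r; have iK := retractK r.
pose Y := rsub (submod_ker pA); exists Y.
pose e : 'End(M) := (\1 - (i \o p))%VF.
have eE x : e x = x - i (p x) by rewrite add_lfunE opp_lfunE id_lfunE comp_lfunE.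
have eA : Alin e by apply: AlinB; [apply: Alin_id | apply: Alin_comp].
have e_ker x : e x \in lker p by rewrite memv_ker eE linearB /= iK subrr.
pose q : 'Hom(M, Y) := corestr (lker p) e; pose j : 'Hom(Y, M) := incl (lker p).
have qE x : j (q x) = x - i (p x).
  by rewrite /j inclE -eE; apply: corestrE.
have qA : Alin q.
  by apply: Alin_corestr => //; apply/subvP => _ /memv_imgP[x _ ->].
have jA : Alin j := @Alin_incl _ _ M _ _.
have pj y : p (j y) = 0.
  by apply/eqP; rewrite -memv_ker /j inclE subvsP.
have jK : cancel j q.
  move=> y; apply: subvs_inj; rewrite -[LHS]inclE -/j qE pj linear0 subr0.
  by rewrite /j inclE.
split; last 2 first.
- by rewrite dimvf.
- by exists j, q; split=> //; apply/lfunP => y; rewrite comp_lfunE jK id_lfunE.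
have [_ p1A _] := retract_inl X Y; have [_ p2A _] := retract_inr X Y.
have q0 x : q (i x) = 0.
  by apply: subvs_inj; rewrite -[LHS]inclE -/j qE iK subrr.
exists (dsum_pair p q); first exact/homAP/Alin_pair.
pose s : 'Hom(dsum X Y, M) := ((i \o dsum_fst X Y) + (j \o dsum_snd X Y))%VF.
have sE x y : s ((x, y) : dsum X Y) = i x + j y.
  rewrite /s add_lfunE [(i \o _)%VF _]comp_lfunE [(j \o _)%VF _]comp_lfunE.
  by rewrite dsum_fstE dsum_sndE.
exists s; first by apply/homAP => -[x y] a; rewrite !sE iA jA ractD.
split; apply/lfunP.
  by move=> x; rewrite comp_lfunE dsum_pairE sE qE addrC subrK id_lfunE.
move=> [x y]; rewrite comp_lfunE dsum_pairE sE id_lfunE.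
by rewrite !linearD /= iK pj q0 jK addr0 add0r.
Qed.


Lemma retract_dim X M (i : 'Hom(X, M)) (p : 'Hom(M, X)) :
  retract i p -> (\dim (lker p) + \dim {:X} = \dim {:M})%N.
Proof.
move=> r; have <- : limg p = fullv.
  by apply/vspaceP => x; rewrite memvf -(retractK r x) memv_img ?memvf.
by rewrite -[RHS](limg_ker_dim p) capfv.
Qed.

(** * Endomorphisms of indecomposable modules *)

Lemma indecomposable_retract X M (i : 'Hom(X, M)) (p : 'Hom(M, X)) :
  indecomposable M -> retract i p -> ~ is_zero X -> lker p = 0%VS.
Proof.
move=> [_ indM] r X0; have [Y [isoM dimY _]] := retract_iso_dsum r.
have [//|/vs_zeroP/eqP Y0] := indM _ _ isoM.
by apply/eqP; rewrite -dimv_eq0 -dimY Y0 dimv0.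
Qed.

(** By Fitting's lemma the image of a high power of [h] is a summand; were it nonzero, that power
    and hence [h] would be injective. *)
Lemma indecomposable_endo X (h : 'End(X)) : indecomposable X -> Alin h ->
  lker h <> 0%VS -> exists n, powlf h n = 0.
Proof.
move=> indX hA h_ker; have [m fit] := fitting h.
(* The exponent is positive, so the kernel of the power contains that of [h]. *)
have FA := Alin_powlf m.+1 hA.
have [p r kerp] := fitting_retract FA (fun x => fit _ x (leqnSn m)).
exists m.+1; apply: NNPP => F0; apply: h_ker.
have kerF : lker (powlf h m.+1) = 0%VS.
  rewrite -kerp; apply: indecomposable_retract r _ => // I0; apply: F0.
  apply/lfunP => x; rewrite zero_lfunE.
  exact (congr1 vsval (I0 (Subvs (memv_img (powlf h m.+1) (memvf x))))).
apply: subv_anti; rewrite sub0v -kerF andbT.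
by have := sub_ker_powlf h (ltn0Sn m); rewrite [powlf h 1]comp_lfun1r.
Qed.

(* Nakayama's lemma for [X] over its endomorphism ring, which is local. *)
Lemma nonunits_proper X : indecomposable X ->
  exists2 W : {vspace X}, W <> fullv &
    forall c : 'End(X), Alin c -> lker c <> 0%VS -> (limg c <= W)%VS.
Proof.
move=> indX; have [X0 _] := indX.
(* [W] is a proper subspace stable under all endomorphisms, of maximal dimension. *)
pose Q (W : {vspace X}) :=
  W <> fullv /\ forall e : 'End(X), Alin e -> (e @: W <= W)%VS.
have Q0 : Q 0%VS.
  split=> [X00|e _]; last by rewrite limg0.
  by apply: X0; apply/vs_zeroP; rewrite X00.
have leX W : Q W -> (\dim W <= \dim {:X})%N by rewrite dimvS ?subvf.
have [W [W_neq stabW] maxW] := argmaxP leX Q0; exists W => // c cA c_ker.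
apply/subvP => _ /memv_imgP[x _ ->]; apply: contraT => cxW.
pose ev (z : X) : 'Hom('End(X), X) := linfun (fun e : 'End(X) => e z).
have evE z (e : 'End(X)) : ev z e = e z.
  by rewrite linfunE // => k e1 e2; rewrite lfunLE.
(* [Z] is stable under endomorphisms; if it were proper, maximality of [W] would put [c x] in
   [W]. *)
pose Z := (ev (c x) @: homA X X + W)%VS.
have ZX : Z = fullv.
  apply: NNPP => Z_neq; case/negP: cxW.
  have QZ : Q Z.
    split=> // e eA;
      rewrite limgD subv_add (subv_trans (stabW e eA)) ?addvSr //.
    rewrite andbT; apply: subv_trans (addvSl _ _).
    apply/subvP => _ /memv_imgP[_ /memv_imgP[e' /homAP e'A ->] ->].
    rewrite evE -comp_lfunE -evE memv_img //; exact/homAP/Alin_comp.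
  have -> : W = Z by apply/eqP; rewrite eqEdim addvSr maxW.
  have cxE : ev (c x) \1%VF = c x by rewrite evE id_lfunE.
  apply: (subvP (addvSl _ _)); rewrite -[z in z \in _]cxE memv_img //.
  exact/homAP/Alin_id.
have /memv_addP[_ /memv_imgP[e /homAP eA ->] [w wW xE]] : x \in Z.
  by rewrite ZX memvf.
rewrite evE in xE; pose d : 'End(X) := (e \o c)%VF.
have dA : Alin d := Alin_comp cA eA.
have d_ker : lker d <> 0%VS.
  move=> d0; apply: c_ker; apply: subv_anti; rewrite sub0v andbT -d0.
  by apply/subvP => z; rewrite !memv_ker comp_lfunE => /eqP->; rewrite linear0.
(* [d] is nilpotent, so [\1 - d] is invertible; as it sends [x] into [W], both [x] and [c x] lie in
   [W]. *)
have [n /powlf_eq0_ker_sub1 u_ker] := indecomposable_endo indX dA d_ker.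
have uA : Alin (\1 - d)%VF by apply: AlinB => //; apply: Alin_id.
have [uVA uVu _] := Alin_endo_inv uA u_ker.
have ux : (\1 - d)%VF x = w.
  by rewrite add_lfunE opp_lfunE id_lfunE comp_lfunE {1}xE addrC addKr.
case/negP: cxW; rewrite -[x]id_lfunE -uVu comp_lfunE ux.
by rewrite (subvP (stabW c cA)) // memv_img // (subvP (stabW _ uVA)) // memv_img.
Qed.

(** The images of the composites from [X] through [Y] to [X] span [X], so by [nonunits_proper] one
    composite is injective. It makes [X] a nonzero summand of the indecomposable [Y]. *)
Lemma indecomposable_fac_iso X Y :
  indecomposable X -> indecomposable Y ->
  trace X Y = fullv -> trace Y X = fullv -> iso X Y.
Proof.
move=> indX indY tXY tYX; have [W W_neq nonunitW] := nonunits_proper indX.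
have [a [b [aA bA ab_ker]]] : exists (a : 'Hom(Y, X)) (b : 'Hom(X, Y)),
    [/\ Alin a, Alin b & lker (a \o b)%VF = 0%VS].
  apply: NNPP => no_ab; apply: W_neq; apply: subv_anti; rewrite subvf -tYX.
  apply: trace_sub => a aA; rewrite -tXY limg_sum.
  apply/subv_sumP => i _; rewrite -limg_comp.
  have bA : Alin (vbasis (homA X Y))`_i.
    by apply/homAP/vbasis_mem/mem_nth; rewrite size_tuple.
  apply: nonunitW => [|ab0]; first exact: Alin_comp.
  by apply: no_ab; exists a, (vbasis (homA X Y))`_i.
have [uVA uVu _] := Alin_endo_inv (Alin_comp bA aA) ab_ker.
pose p : 'Hom(Y, X) := ((a \o b)^-1 \o a)%VF.
have r : retract b p by split=> //; [apply: Alin_comp | rewrite -comp_lfunA].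
have p_ker := indecomposable_retract indY r (proj1 indX).
have [_ pA _] := r; apply/iso_sym/(iso_bij pA p_ker)/vspaceP => x.
by rewrite memvf -(retractK r x) memv_img ?memvf.
Qed.

(** * Decompositions and counting *)

Lemma indecomposable_decomposition M : presented_rigid M ->
  exists k (X : 'I_k -> rmod A),
    (forall i, indecomposable (X i) /\ presented_rigid (X i)) /\
    iso M (\big[@dsum K A/rmod0 A]_(i < k) X i).
Proof.
have [d] := ubnP (\dim {:M}); elim: d M => // d IHd M /ltnSE leMd presM.
have [M0|M0] := classic (is_zero M).
  exists 0%N, (fun=> M); split=> [[]//|]; rewrite big_ord0.
  apply: (@iso_bij _ _ (0 : 'Hom(M, rmod0 A))); first exact: Alin0.
    by apply/vspaceP => x; rewrite (M0 x) !mem0v.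
  by apply/vspaceP => x; rewrite [x]thinmx0 !mem0v.
pose Q X := ~ is_zero X /\ exists (i : 'Hom(X, M)) (p : 'Hom(M, X)), retract i p.
have QM : Q M by split=> //; apply/iso_retract/iso_refl.
(* A nonzero summand of least dimension is indecomposable, since its own nonzero summands are
   summands of [M] too. The complement is left to induction. *)
have [X [X0 [i [p rX]]] minX] := argminP (fun X => \dim {:X}) QM.
have indX : indecomposable X.
  split=> // X1 X2 [a /homAP aA [b /homAP bA [ba ab]]].
  have [X10|X10] := classic (is_zero X1); [by left | right].
  have ra : retract b a by split.
  have r1 := retract_trans (retract_inl X1 X2) ra.
  have QX1 : Q X1 by split=> //; do 2!eexists; apply: retract_trans r1 rX.
  have r1_ker : lker (dsum_fst X1 X2 \o a)%VF = 0%VS.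
    apply/eqP; rewrite -dimv_eq0 -leqn0 -(leq_add2r (\dim {:X1})).
    by rewrite (retract_dim r1) minX.
  move=> y; rewrite -(retractK (retract_inr X1 X2) y).
  rewrite -(retractK ra (dsum_inr X1 X2 y)).
  have: b (dsum_inr X1 X2 y) \in lker (dsum_fst X1 X2 \o a)%VF.
    by rewrite memv_ker comp_lfunE (retractK ra) dsum_inrE dsum_fstE.
  by rewrite r1_ker memv0 => /eqP->; rewrite !linear0.
have [Y [isoM dimY [j [q rY]]]] := retract_iso_dsum rX.
have [||k [Z [goodZ isoY]]] := IHd Y.
- apply: leq_trans leMd; rewrite dimY -(retract_dim rX) -addn1 leq_add2l.
  by rewrite lt0n dimv_eq0; apply/vs_zeroP.
- exact: presented_retract presM rY.
exists k.+1, (fun i => if unlift ord0 i is Some i' then Z i' else X);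
  split=> [i'|].
  case: unliftP => [i'' _|_]; first exact: goodZ.
  by split=> //; apply: presented_retract presM rX.
rewrite big_ord_recl unlift_none; under eq_bigr do rewrite liftK.
apply: iso_trans isoM _; apply: iso_dsum isoY; exact: iso_refl.
Qed.

(** [epsilon] picks one representative per label; a label carried by no module gets an arbitrary
    one. *)
Lemma finitely_many_classes (S : finType) (Q : rmod A -> Prop)
    (R : rmod A -> S -> Prop) :
  (forall X, Q X -> exists s, R X s) ->
  (forall X Y s, Q X -> Q Y -> R X s -> R Y s -> iso X Y) ->
  exists k (Z : 'I_k -> rmod A), forall X, Q X -> exists i, iso X (Z i).
Proof.
move=> totR injR.
pose Z s := epsilon (inhabits (rmod0 A)) (fun X => Q X /\ R X s).
exists #|S|, (fun i => Z (enum_val i)) => X QX; have [s RXs] := totR X QX.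
exists (enum_rank s); rewrite enum_rankK.
have [|QZ RZs] := epsilon_spec (inhabits (rmod0 A)) (fun X => Q X /\ R X s).
  by exists X.
exact: injR RXs RZs.
Qed.

(** A module is labelled by the sign pattern of any of its rigid presentations. Modules sharing a
    label lie in each other's Fac, so they are isomorphic if indecomposable. *)
Lemma finitely_many_indecomposables (b : nat) :
  (forall B : rmod A, brick B -> exists2 l, has_length B l & (l <= b)%N) ->
  exists k (Z : 'I_k -> rmod A), forall X,
    indecomposable X /\ presented_rigid X -> exists i, iso X (Z i).
Proof.
move=> le_b; have [n [C [C0 Cn covC]]] := exists_length (regular A).
pose R X s := exists P1 P0 (f : 'Hom(P1, P0)) (g : 'Hom(P0, X)),
  rigid_presentation f g /\ s = gsigns n C b P1 P0.
have fac_sub X Y s : presented_rigid Y -> R X s -> R Y s ->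
    trace Y X = fullv.
  move=> presY [P1 [P0 [f [g [pres sE]]]]] [P1' [P0' [f' [g' [pres' sE']]]]].
  apply: (@fac_bricks _ _ X Y presY _ X (fac_self X)) => B brickB.
  have [l lenB le_lb] := le_b B brickB.
  by apply: (fac_gsigns C0 Cn covC pres pres' _ lenB le_lb); rewrite -sE.
apply: (@finitely_many_classes _ _ R) => [X [_ [P1 [P0 [f [g pres]]]]]|].
  by exists (gsigns n C b P1 P0), P1, P0, f, g.
move=> X Y s [indX presX] [indY presY] RX RY.
by apply: indecomposable_fac_iso => //; apply: fac_sub RX || apply: fac_sub RY.
Qed.

Definition big_dsum k (Z : 'I_k -> rmod A) (s : seq 'I_k) : rmod A :=
  \big[@dsum K A/rmod0 A]_(i <- s) Z i.

Lemma iso_big_dsum I (s : seq I) (X Y : I -> rmod A) :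
  (forall i, iso (X i) (Y i)) ->
  iso (\big[@dsum K A/rmod0 A]_(i <- s) X i)
      (\big[@dsum K A/rmod0 A]_(i <- s) Y i).
Proof.
move=> isoXY; elim: s => [|i s IHs]; first by rewrite !big_nil; apply: iso_refl.
by rewrite !big_cons; apply: iso_dsum.
Qed.

(* In a basic module no two indecomposable summands share the same [Z i], which
   bounds their number by [k]. *)
Lemma basic_big_dsum k (Z : 'I_k -> rmod A) M :
  (forall X, indecomposable X /\ presented_rigid X -> exists i, iso X (Z i)) ->
  basic M -> presented_rigid M ->
  exists s : k.-bseq 'I_k, iso M (big_dsum Z s).
Proof.
move=> repZ basicM /indecomposable_decomposition[m [X [goodX isoM]]].
have [c cE] : exists c : {ffun 'I_m -> 'I_k}, forall i, iso (X i) (Z (c i)).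
  have cP i := constructive_indefinite_description _ (repZ _ (goodX i)).
  by exists [ffun i => sval (cP i)] => i; rewrite ffunE; apply: svalP (cP i).
have c_inj : injective c.
  move=> i j cij; apply: basicM isoM _ _ _ => [l|]; first by have [] := goodX l.
  by apply: iso_trans (cE i) _; rewrite cij; apply: iso_sym.
have le_mk : (size [seq c i | i <- index_enum 'I_m] <= k)%N.
  rewrite size_map [index_enum _]unlock -enumT size_enum_ord.
  by have := leq_card c c_inj; rewrite !card_ord.
exists (Bseq le_mk); apply: iso_trans isoM _.
rewrite /big_dsum /= big_map; exact: iso_big_dsum.
Qed.

End KrullSchmidt.

Theorem theorem1p1 (K : fieldType) (A : falgType K) :
  (exists2 n : nat, (0 < n)%N &
     forall B : rmod A, brick B -> exists2 l : nat, has_length B l & (l < n)%N) ->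
  tau_tilting_finite A.
Proof.
case=> n _ ltn; have le_n (B : rmod A) :
    brick B -> exists2 l, has_length B l & (l <= n)%N.
  by move=> /ltn[l lenB /ltnW]; exists l.
have [k [Z repZ]] := finitely_many_indecomposables le_n.
(* Up to isomorphism a pair is given by two lists of at most [k] indices. *)
pose I := (k.-bseq 'I_k * k.-bseq 'I_k)%type.
exists #|{: I}|, (fun i => let s : I := enum_val i in
  (big_dsum Z s.1, big_dsum Z s.2)).
move=> M P [[basicM basicP projP rigidM _] _].
have [s isoM] := basic_big_dsum repZ basicM (tau_rigid_presented rigidM).
have [t isoP] := basic_big_dsum repZ basicP (projective_presented projP).
by exists (enum_rank ((s, t) : I)); rewrite enum_rankK.
Qed.
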